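(* Let $\mathcal{C}(\mathcal{Z})$ be the discrete cluster category associated to an admissible subset $\mathcal{Z}\subseteq S^1$ with $n$ limit points. Let $n\geq 2$ and let $(\mathcal{X},\mathcal{Y})$ be a t-structure in $\mathcal{C}(\mathcal{Z})$ with associated $\overline{\mathcal{Z}}$-decorated non-crossing partition $(\mathcal{P},\mathbf{x})$ (i.e. $\mathcal{X}=\mathcal{X}(\mathcal{P},\mathbf{x})$). Then $(\mathcal{X},\mathcal{Y})$ is 1. bounded above if and only if $\mathcal{P}$ is the coarsest partition of $[n]$: $\mathcal{P}=\{[n]\}$; 2. bounded below if and only if $\mathcal{P}$ is the finest partition of $[n]$: $\mathcal{P}=\{\{1\},\{2\},\ldots,\{n\}\}$.
   Context: **Combinatorial setting.** $\mathbb{K}$ is a field. $S^1$ is the unit circle with anti-clockwise cyclic order: for pairwise distinct $x,y,z\in S^1$, $x<y<z$ means that going anti-clockwise one meets first $x$, then $y$, then $z$; for $m\ge 3$, $x_1<\dots<x_m$ means $x_i<x_{i+1}<x_{i+2}$ for all $i$ (indices modulo $m$). $\mathcal{Z}\subseteq S^1$ is admissible: discrete, infinite, with set of limit points $L(\mathcal{Z})=\overline{\mathcal{Z}}\setminus\mathcal{Z}$ ($\overline{\mathcal{Z}}$ the topological closure) finite of cardinality $n$, every limit point being a two-sided limit point. The limit points are $a_1<\dots<a_n$, indices modulo $n$ (so $a_{n+1}=a_1$). For $a,b\in\overline{\mathcal{Z}}$, $(a,b)=\{c\in\overline{\mathcal{Z}}\mid a<c<b\}$, and $[a,b],[a,b),(a,b]$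 are defined analogously as subsets of $\overline{\mathcal{Z}}$; $(a,a]=\varnothing$. Each $z\in\mathcal{Z}$ has an immediate successor $z^+$ and predecessor $z^-$ in $\mathcal{Z}$ (anti-clockwise, resp. clockwise neighbour). An arc of $\mathcal{Z}$ is a 2-element subset $\{z_0,z_1\}\subseteq\mathcal{Z}$ with $z_1\notin\{z_0^-,z_0,z_0^+\}$. Arcs $\{y_0,y_1\},\{y_0',y_1'\}$ cross if $y_0<y_0'<y_1<y_1'$ or $y_0<y_1'<y_1<y_0'$. **The category.** $\mathcal{C}(\mathcal{Z})$ is the discrete cluster category of Igusa–Todorov: a $\mathbb{K}$-linear, 2-Calabi–Yau, Krull–Schmidt triangulated category with suspension $\Sigma$ whose non-zero indecomposable objects correspond to arcs of $\mathcal{Z}$ (same notation for arc and object), with: - $\Sigma\{y_0,y_1\}=\{y_0^-,y_1^-\}$; - $\mathrm{Hom}(\{y_0,y_1\},\Sigma\{y_0',y_1'\})=\mathbb{K}$ if the arcs $\{y_0,y_1\}$ and $\{y'_0,y'_1\}$ cross, and $0$ otherwise; - a non-zero morphism $\{y_0,y_1\}\to\{y_0',y_1'\}$ with $y_0<y_0'^+<y_1<y_1'^+$ factors through an indecomposable $S$ iff $S=\{s_0,s_1\}$ with $y_0\le s_0\le y_0'$ and $y_1\le s_1\le y_1'$; - if $y_0<y_0'<y_1<y_1'$, every non-zero $f:\{y_0,y_1\}\to\Sigma\{y_0',y_1'\}$ sits in a triangle $\{y_0',y_1'\}\to X\oplus Z\to\{y_0,y_1\}\xrightarrow{f}\Sigma\{y_0',y_1'\}$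 with $X=\{y_0,y_0'\}$, $Z=\{y_1,y_1'\}$ (read as $0$ when not an arc); the components of the first two maps to and from $X$, $Z$ are non-zero when the corresponding objects are non-zero. All subcategories are full and closed under direct sums and summands; $\mathrm{add}(\mathcal{Y})$ is the smallest such subcategory containing the set of arcs $\mathcal{Y}$. **t-structures.** A torsion pair in a triangulated category $\mathcal{T}$ is a pair $(\mathcal{X},\mathcal{Y})$ of subcategories closed under direct summands with $\mathrm{Hom}(X,Y)=0$ for $X\in\mathcal{X},Y\in\mathcal{Y}$ and such that every $T\in\mathcal{T}$ has a distinguished triangle $X\to T\to Y\to\Sigma X$ with $X\in\mathcal{X},Y\in\mathcal{Y}$. A t-structure is a torsion pair with $\Sigma\mathcal{X}\subseteq\mathcal{X}$; $\mathcal{X}$ is its aisle, $\mathcal{Y}=\mathcal{X}^\perp$ its coaisle. A t-structure in $\mathcal{C}(\mathcal{Z})$ is bounded above if $\bigcup_{k\in\mathbb{Z}}\Sigma^k\mathcal{X}=\mathcal{C}(\mathcal{Z})$ and bounded below if $\bigcup_{k\in\mathbb{Z}}\Sigma^k\mathcal{Y}=\mathcal{C}(\mathcal{Z})$. **Decorated partitions.** A non-crossing partition $\mathcal{P}=\{B_m\mid m\in I\}$ of $[n]=\{1,\dots,n\}$ is a partition of $[n]$ into non-empty blocks such that whenever $i<k<j<l$ with $i,j\in B_{m_1}$, $k,l\in B_{m_2}$, then $m_1=m_2$. $i$ is a singleton of $\mathcal{P}$ if $\{i\}\in\mathcal{P}$; $i$ is an adjacency of $\mathcal{P}$ if $i$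 and $i+1$ (cyclically modulo $n$) are in the same block. A $\overline{\mathcal{Z}}$-decoration of $\mathcal{P}$ is a tuple $\mathbf{x}=(x_1,\ldots,x_n)$ with $x_i\in[a_i,a_{i+1})$ if $i$ is a singleton, $x_i\in(a_i,a_{i+1}]$ if $i$ is an adjacency, and $x_i\in(a_i,a_{i+1})$ otherwise. Set $$\mathcal{X}(\mathcal{P},\mathbf{x})=\mathrm{add}\{\{y_0,y_1\}\text{ arc of }\mathcal{Z}\mid y_0,y_1\in\textstyle\bigcup_{i\in B}(a_i,x_i]\text{ for some }B\in\mathcal{P}\}.$$ The assignment $(\mathcal{P},\mathbf{x})\mapsto\mathcal{X}(\mathcal{P},\mathbf{x})$ is a bijection from $\overline{\mathcal{Z}}$-decorated non-crossing partitions of $[n]$ to aisles of t-structures in $\mathcal{C}(\mathcal{Z})$. *)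

(* Defs.v *)
From HB Require Import structures.
From mathcomp Require Import all_boot all_order all_algebra.
From mathcomp Require Import all_classical all_reals all_analysis.

Set Implicit Arguments.
Unset Strict Implicit.
Unset Printing Implicit Defensive.
Import Order.TTheory GRing.Theory Num.Theory.
Import numFieldNormedType.Exports.

Local Open Scope classical_set_scope.
Local Open Scope ring_scope.

(** * K-linear categories *)

Record linear_category (K : fieldType) := LinearCategory {
  ob :> Type;
  hom : ob -> ob -> lmodType K;
  idm : forall A, hom A A;
  comp : forall A B C, hom B C -> hom A B -> hom A C;
  comp_idl : forall A B (f : hom A B), comp (idm B) f = f;
  comp_idr : forall A B (f : hom A B), comp f (idm A) = f;
  compA : forall A B C D (h : hom C D) (g : hom B C) (f : hom A B),
    comp h (comp g f) = comp (comp h g) f;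
  comp_linearl : forall A B C (f : hom A B),
    linear (fun g : hom B C => comp g f);
  comp_linearr : forall A B C (g : hom B C),
    linear (fun f : hom A B => comp g f)
}.

Arguments hom {K} _ _ _.
Arguments idm {K _} A.

Notation "g ∘ f" := (comp g f) (at level 40, left associativity).

Definition is_iso (K : fieldType) (T : linear_category K) (A B : T)
    (f : hom T A B) : Prop :=
  exists g : hom T B A, g ∘ f = idm A /\ f ∘ g = idm B.

Definition isomorphic (K : fieldType) (T : linear_category K) (A B : T) : Prop :=
  exists f : hom T A B, is_iso f.

Definition is_zero (K : fieldType) (T : linear_category K) (A : T) : Prop :=
  forall B : T, (forall f : hom T A B, f = 0) /\ (forall f : hom T B A, f = 0).

Definition biproduct (K : fieldType) (T : linear_category K) (I : finType)
    (F : I -> T) (S : T)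
    (inj : forall i, hom T (F i) S) (prj : forall i, hom T S (F i)) : Prop :=
  [/\ forall i, prj i ∘ inj i = idm (F i),
      forall i j, i != j -> prj j ∘ inj i = 0
    & \sum_i (inj i ∘ prj i) = idm S].

Definition direct_sum (K : fieldType) (T : linear_category K) (I : finType)
    (F : I -> T) (S : T) : Prop :=
  exists inj : forall i, hom T (F i) S,
  exists prj : forall i, hom T S (F i), biproduct inj prj.

(* The empty family gives a zero object. *)
Definition additive (K : fieldType) (T : linear_category K) : Prop :=
  forall (m : nat) (F : 'I_m -> T), exists S : T, direct_sum F S.

Definition indecomposable (K : fieldType) (T : linear_category K) (A : T) : Prop :=
  ~ is_zero A /\
  forall F : bool -> T, direct_sum F A -> exists b, is_zero (F b).

Definition local_end (K : fieldType) (T : linear_category K) (A : T) : Prop :=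
  idm A <> 0 /\ forall f : hom T A A, is_iso f \/ is_iso (idm A - f).

Definition krull_schmidt (K : fieldType) (T : linear_category K) : Prop :=
  forall A : T, exists (m : nat) (F : 'I_m -> T),
    direct_sum F A /\ forall i, local_end (F i).

(* Full subcategories are sets of objects. The cases m = 0 and m = 1 of the
   first closure property give zero objects and closure under isomorphism. *)
Definition subcategory (K : fieldType) (T : linear_category K) (X : set T) : Prop :=
  (forall (m : nat) (F : 'I_m -> T) (S : T),
     direct_sum F S -> (forall i, X (F i)) -> X S) /\
  (forall (m : nat) (F : 'I_m -> T) (S : T),
     direct_sum F S -> X S -> forall i, X (F i)).

Definition add_closure (K : fieldType) (T : linear_category K) (G : set T) : set T :=
  smallest (@subcategory K T) G.

(** * Triangulated categories *)

Record triangulated_category (K : fieldType) := TriangulatedCategory {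
  tri_cat :> linear_category K;
  tri_additive : additive tri_cat;
  (* the suspension, a K-linear autoequivalence *)
  sus : tri_cat -> tri_cat;
  sus_hom : forall A B, hom tri_cat A B -> hom tri_cat (sus A) (sus B);
  sus_id : forall A, sus_hom (idm A) = idm (sus A);
  sus_comp : forall A B C (g : hom tri_cat B C) (f : hom tri_cat A B),
    sus_hom (g ∘ f) = sus_hom g ∘ sus_hom f;
  sus_linear : forall A B, linear (@sus_hom A B);
  sus_fully_faithful : forall A B, bijective (@sus_hom A B);
  sus_ess_surj : forall B, exists A, isomorphic (sus A) B;
  (* dist f g h : A -f-> B -g-> C -h-> sus A is distinguished *)
  dist : forall A B C, hom tri_cat A B -> hom tri_cat B C ->
    hom tri_cat C (sus A) -> Prop;
  dist_iso : forall A B C A' B' C'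
      (f : hom tri_cat A B) (g : hom tri_cat B C) (h : hom tri_cat C (sus A))
      (f' : hom tri_cat A' B') (g' : hom tri_cat B' C')
      (h' : hom tri_cat C' (sus A'))
      (u : hom tri_cat A A') (v : hom tri_cat B B') (w : hom tri_cat C C'),
    is_iso u -> is_iso v -> is_iso w ->
    v ∘ f = f' ∘ u -> w ∘ g = g' ∘ v -> sus_hom u ∘ h = h' ∘ w ->
    dist f g h -> dist f' g' h';
  dist_id : forall A O : tri_cat, is_zero O ->
    dist (idm A) (0 : hom tri_cat A O) (0 : hom tri_cat O (sus A));
  dist_cone : forall A B (f : hom tri_cat A B),
    exists (C : tri_cat) (g : hom tri_cat B C) (h : hom tri_cat C (sus A)),
      dist f g h;
  dist_rot : forall A B C (f : hom tri_cat A B) (g : hom tri_cat B C)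
      (h : hom tri_cat C (sus A)),
    dist f g h <-> dist g h (- sus_hom f);
  dist_morphism : forall A B C A' B' C'
      (f : hom tri_cat A B) (g : hom tri_cat B C) (h : hom tri_cat C (sus A))
      (f' : hom tri_cat A' B') (g' : hom tri_cat B' C')
      (h' : hom tri_cat C' (sus A'))
      (u : hom tri_cat A A') (v : hom tri_cat B B'),
    dist f g h -> dist f' g' h' -> v ∘ f = f' ∘ u ->
    exists w : hom tri_cat C C', w ∘ g = g' ∘ v /\ sus_hom u ∘ h = h' ∘ w;
  dist_octahedral : forall A B C Cf Cg Cgf
      (f : hom tri_cat A B) (f' : hom tri_cat B Cf)
      (f'' : hom tri_cat Cf (sus A))
      (g : hom tri_cat B C) (g' : hom tri_cat C Cg)
      (g'' : hom tri_cat Cg (sus B))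
      (k : hom tri_cat C Cgf) (k' : hom tri_cat Cgf (sus A)),
    dist f f' f'' -> dist g g' g'' -> dist (g ∘ f) k k' ->
    exists (u : hom tri_cat Cf Cgf) (v : hom tri_cat Cgf Cg),
      [/\ dist u v (sus_hom f' ∘ g''),
          u ∘ f' = k ∘ g, v ∘ k = g', k' ∘ u = f''
        & g'' ∘ v = sus_hom f ∘ k']
}.

Arguments sus {K _} A.
Arguments sus_hom {K _ A B} f.

Definition hom_finite (K : fieldType) (T : linear_category K) : Prop :=
  forall A B : T, exists (m : nat) (e : 'I_m -> hom T A B),
    forall f, exists c : 'I_m -> K, f = \sum_i c i *: e i.

(* phi A B f is a linear form on Hom(B, sus (sus A)); the clauses say that
   phi A B is a K-linear bijection from Hom(A, B) onto the dual of
   Hom(B, sus (sus A)), natural in A and in B. *)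
Definition two_calabi_yau (K : fieldType) (T : triangulated_category K) : Prop :=
  hom_finite T /\
  exists phi : forall A B : T, hom T A B -> hom T B (sus (sus A)) -> K,
    [/\ forall A B f, scalar (phi A B f),
        forall A B g, scalar (fun f => phi A B f g),
        forall A B (l : hom T B (sus (sus A)) -> K), scalar l ->
          exists! f, phi A B f = l,
        forall A' A B (u : hom T A' A) (f : hom T A B)
            (g : hom T B (sus (sus A'))),
          phi A' B (f ∘ u) g = phi A B f (sus_hom (sus_hom u) ∘ g)
      & forall A B B' (v : hom T B B') (f : hom T A B)
            (g : hom T B' (sus (sus A))),
          phi A B' (v ∘ f) g = phi A B f (g ∘ v)].

(** * t-structures *)

Definition torsion_pair (K : fieldType) (T : triangulated_category K)
    (X Y : set T) : Prop :=
  [/\ subcategory X, subcategory Y,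
      forall A B, X A -> Y B -> forall f : hom T A B, f = 0
    & forall C : T, exists (A B : T) (f : hom T A C) (g : hom T C B)
        (h : hom T B (sus A)), [/\ X A, Y B & dist f g h]].

Definition t_structure (K : fieldType) (T : triangulated_category K)
    (X Y : set T) : Prop :=
  torsion_pair X Y /\ forall A, X A -> X (sus A).

(* The subcategory sus^k X. For k = - m.+1 its objects are those of the form
   sus^(- m.+1) B with B in X, that is, the A with sus^(m.+1) A in X. *)
Definition sus_sub (K : fieldType) (T : triangulated_category K) (k : int)
    (X : set T) : set T :=
  match k with
  | Posz m => [set A | exists2 B, X B & isomorphic A (iter m sus B)]
  | Negz m => [set A | exists2 B, X B & isomorphic (iter m.+1 sus A) B]
  end.

Definition bounded_above (K : fieldType) (T : triangulated_category K)
    (X Y : set T) : Prop :=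
  \bigcup_(k in [set: int]) sus_sub k X = [set: T].

Definition bounded_below (K : fieldType) (T : triangulated_category K)
    (X Y : set T) : Prop :=
  \bigcup_(k in [set: int]) sus_sub k Y = [set: T].

(** * The circle and admissible subsets *)

Definition circle (R : realType) : set (R * R) :=
  [set p | p.1 ^+ 2 + p.2 ^+ 2 = 1].

Definition circle_pt (R : realType) (t : R) : R * R := (cos t, sin t).

(* x < y < z in the anti-clockwise cyclic order; in particular x, y, z are
   pairwise distinct. *)
Definition ccw (R : realType) (x y z : R * R) : Prop :=
  exists t u v : R,
    [/\ x = circle_pt t, y = circle_pt u, z = circle_pt v
      & [/\ t < u, u < v & v < t + 2 * pi]].

Definition ccw4 (R : realType) (x1 x2 x3 x4 : R * R) : Prop :=
  [/\ ccw x1 x2 x3, ccw x2 x3 x4, ccw x3 x4 x1 & ccw x4 x1 x2].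

Definition limit_set (R : realType) (Z : set (R * R)) : set (R * R) :=
  closure Z `\` Z.

(* a is approached by Z both anti-clockwise and clockwise *)
Definition two_sided (R : realType) (Z : set (R * R)) (a : R * R) : Prop :=
  forall t e : R, a = circle_pt t -> 0 < e ->
    (exists2 u : R, t - e < u < t & Z (circle_pt u)) /\
    (exists2 u : R, t < u < t + e & Z (circle_pt u)).

Definition admissible (R : realType) (Z : set (R * R)) : Prop :=
  [/\ Z `<=` @circle R, Z `<=` isolated Z, infinite_set Z,
      finite_set (limit_set Z)
    & forall a, limit_set Z a -> two_sided Z a].

(* a_0 < ... < a_(n-1) are the limit points of Z. The order is required for all
   triples i < j < k: comparing consecutive points only would not exclude a
   sequence that winds more than once around the circle, such as a pentagram. *)
Definition limit_points (R : realType) (Z : set (R * R)) (n : nat)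
    (a : 'I_n -> R * R) : Prop :=
  [/\ injective a, range a = limit_set Z
    & forall i j k : 'I_n, (i < j)%N -> (j < k)%N -> ccw (a i) (a j) (a k)].

(* intervals in the closure of Z; (a, a] and [a, a) are empty *)
Definition itv_oo (R : realType) (Z : set (R * R)) (a b : R * R) : set (R * R) :=
  [set c | closure Z c /\ ccw a c b].
Definition itv_co (R : realType) (Z : set (R * R)) (a b : R * R) : set (R * R) :=
  [set c | closure Z c /\ a <> b /\ (c = a \/ ccw a c b)].
Definition itv_oc (R : realType) (Z : set (R * R)) (a b : R * R) : set (R * R) :=
  [set c | closure Z c /\ a <> b /\ (c = b \/ ccw a c b)].
Definition itv_cc (R : realType) (Z : set (R * R)) (a b : R * R) : set (R * R) :=
  [set c | closure Z c /\ (c = a \/ c = b \/ ccw a c b)].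

(* z^+ and z^- for z in Z *)
Definition zsucc (R : realType) (Z : set (R * R)) (z : R * R) : R * R :=
  xget z [set w | [/\ Z w, w <> z & forall c, Z c -> ~ ccw z c w]].
Definition zpred (R : realType) (Z : set (R * R)) (z : R * R) : R * R :=
  xget z [set w | [/\ Z w, w <> z & forall c, Z c -> ~ ccw w c z]].

Definition is_arc (R : realType) (Z : set (R * R)) (A : set (R * R)) : Prop :=
  exists z0 z1, [/\ Z z0, Z z1,
    [/\ z1 <> zpred Z z0, z1 <> z0 & z1 <> zsucc Z z0] & A = [set z0; z1]].

Definition cross (R : realType) (A B : set (R * R)) : Prop :=
  exists x0 x1 y0 y1, [/\ A = [set x0; x1], B = [set y0; y1]
    & ccw4 x0 y0 x1 y1 \/ ccw4 x0 y1 x1 y0].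

(** * Discrete cluster categories *)

Definition vanishes (K : fieldType) (V : lmodType K) : Prop :=
  forall v : V, v = 0.

Definition one_dimensional (K : fieldType) (V : lmodType K) : Prop :=
  exists2 e : V, e <> 0 & forall v : V, exists c : K, v = c *: e.

(* The Igusa-Todorov category of Z, described by its known structure. arc_ob
   sends an arc to the corresponding indecomposable object and, by convention,
   every other set of points to a zero object. *)
Record discrete_cluster_category (R : realType) (K : fieldType)
    (Z : set (R * R)) := DiscreteClusterCategory {
  dcc_cat :> triangulated_category K;
  dcc_krull_schmidt : krull_schmidt dcc_cat;
  dcc_calabi_yau : two_calabi_yau dcc_cat;
  arc_ob : set (R * R) -> dcc_cat;
  arc_ob_indec : forall A, is_arc Z A -> indecomposable (arc_ob A);
  arc_ob_zero : forall A, ~ is_arc Z A -> is_zero (arc_ob A);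
  arc_ob_inj : forall A B, is_arc Z A -> is_arc Z B ->
    isomorphic (arc_ob A) (arc_ob B) -> A = B;
  arc_ob_surj : forall T : dcc_cat, indecomposable T ->
    exists2 A, is_arc Z A & isomorphic T (arc_ob A);
  sus_arc : forall y0 y1, is_arc Z [set y0; y1] ->
    isomorphic (sus (arc_ob [set y0; y1]))
               (arc_ob [set zpred Z y0; zpred Z y1]);
  hom_cross : forall A B, is_arc Z A -> is_arc Z B -> cross A B ->
    one_dimensional (hom dcc_cat (arc_ob A) (sus (arc_ob B)));
  hom_not_cross : forall A B, is_arc Z A -> is_arc Z B -> ~ cross A B ->
    vanishes (hom dcc_cat (arc_ob A) (sus (arc_ob B)));
  hom_factor : forall y0 y1 y0' y1',
    is_arc Z [set y0; y1] -> is_arc Z [set y0'; y1'] ->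
    ccw4 y0 (zsucc Z y0') y1 (zsucc Z y1') ->
    forall f : hom dcc_cat (arc_ob [set y0; y1]) (arc_ob [set y0'; y1']),
    f <> 0 ->
    forall S, is_arc Z S ->
      (exists (g : hom dcc_cat (arc_ob [set y0; y1]) (arc_ob S))
              (h : hom dcc_cat (arc_ob S) (arc_ob [set y0'; y1'])), f = h ∘ g)
      <-> (exists s0 s1, [/\ S = [set s0; s1],
                             itv_cc Z y0 y0' s0 & itv_cc Z y1 y1' s1]);
  arc_triangle : forall y0 y1 y0' y1',
    is_arc Z [set y0; y1] -> is_arc Z [set y0'; y1'] -> ccw4 y0 y0' y1 y1' ->
    forall f : hom dcc_cat (arc_ob [set y0; y1]) (sus (arc_ob [set y0'; y1'])),
    f <> 0 ->
    let side b := if b then [set y0; y0'] else [set y1; y1'] in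
    exists (M : dcc_cat)
           (inj : forall b, hom dcc_cat (arc_ob (side b)) M)
           (prj : forall b, hom dcc_cat M (arc_ob (side b)))
           (u : hom dcc_cat (arc_ob [set y0'; y1']) M)
           (v : hom dcc_cat M (arc_ob [set y0; y1])),
      [/\ biproduct inj prj, dist u v f
        & forall b, is_arc Z (side b) -> prj b ∘ u <> 0 /\ v ∘ inj b <> 0]
}.

Arguments arc_ob {R K Z} _ _.

(** * Decorated non-crossing partitions of [n], with [n] encoded as 'I_n *)

Definition noncrossing_partition (n : nat) (P : {set {set 'I_n}}) : Prop :=
  finset.partition P [set: 'I_n]%SET /\
  forall (B1 B2 : {set 'I_n}) (i k j l : 'I_n),
    B1 \in P -> B2 \in P -> i \in B1 -> j \in B1 -> k \in B2 -> l \in B2 ->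
    (i < k)%N -> (k < j)%N -> (j < l)%N -> B1 = B2.

Definition singleton_of (n : nat) (P : {set {set 'I_n}}) (i : 'I_n) : Prop :=
  [set i]%SET \in P.

(* ordS is the cyclic successor on 'I_n *)
Definition adjacency_of (n : nat) (P : {set {set 'I_n}}) (i : 'I_n) : Prop :=
  exists2 B, B \in P & (i \in B) && (ordS i \in B).

Definition decoration (R : realType) (Z : set (R * R)) (n : nat)
    (a : 'I_n -> R * R) (P : {set {set 'I_n}}) (x : 'I_n -> R * R) : Prop :=
  forall i,
    [/\ singleton_of P i -> itv_co Z (a i) (a (ordS i)) (x i),
        adjacency_of P i -> itv_oc Z (a i) (a (ordS i)) (x i)
      & ~ singleton_of P i -> ~ adjacency_of P i ->
        itv_oo Z (a i) (a (ordS i)) (x i)].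

Definition aisle_of (R : realType) (K : fieldType) (Z : set (R * R))
    (C : discrete_cluster_category K Z) (n : nat) (a : 'I_n -> R * R)
    (P : {set {set 'I_n}}) (x : 'I_n -> R * R) : set C :=
  add_closure [set arc_ob C A | A in [set A | is_arc Z A /\
    exists2 B, B \in P & A `<=` \bigcup_(i in [set` B]) itv_oc Z (a i) (x i)]].

Arguments aisle_of {R K Z} C {n} a P x.

(* Main.v *)
(* Angles identify Z with a disjoint union of copies of the integers, one in each
   interval (a_i, a_(i+1)), and zpred moves every point of such a copy down to
   a_i. So the suspension pushes both endpoints of an arc clockwise within their
   intervals.
   If P = {[n]}, every (a_i, x_i] is an initial segment of its interval, hence
   every arc is in the aisle after enough suspensions. If i and j lie in different
   blocks, no shift of an arc from (a_i, a_(i+1)) to (a_j, a_(j+1)) is in the aisle.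
   An arc W is in the coaisle iff Hom(A, W) = 0 for all arcs A of the aisle, iff no
   such A crosses the desuspension of W. If P is the finest partition, the arcs of
   the aisle have both endpoints in the same (a_i, x_i], and the endpoints of W move
   beyond x_i after enough desuspensions. If i <> j are in one block, any arc from
   (a_i, a_(i+1)) to (a_j, a_(j+1)) is crossed by an arc of the aisle with endpoints
   close to a_i and a_j. *)
From HB Require Import structures.
From mathcomp Require Import all_boot all_order all_algebra.
From mathcomp Require Import ring lra zify.
From mathcomp Require Import all_classical all_reals all_analysis.
Require Import Defs.

Set Implicit Arguments.
Unset Strict Implicit.
Unset Printing Implicit Defensive.
Import Order.TTheory GRing.Theory Num.Theory.
Import numFieldNormedType.Exports.
Local Open Scope classical_set_scope.
Local Open Scope ring_scope.

(** * The circle *)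

Section Circle.
Variable R : realType.
Implicit Types (t u v : R) (p : R * R).

Lemma circle_circle_pt t : circle (circle_pt t).
Proof. by rewrite /circle /= cos2Dsin2. Qed.

Lemma circle_ptD2pi t : circle_pt (t + 2 * pi) = circle_pt t.
Proof. by rewrite /circle_pt mulrC mulr_natr cosD2pi sinD2pi. Qed.

Lemma circle_ptB2pi t : circle_pt (t - 2 * pi) = circle_pt t.
Proof. by rewrite -[LHS]circle_ptD2pi subrK. Qed.

Lemma circle_ptDz t (k : int) : circle_pt (t + k%:~R * (2 * pi)) = circle_pt t.
Proof.
have nat_case (m : nat) (s : R) : circle_pt (s + m%:R * (2 * pi)) = circle_pt s.
  elim: m => [|m IHm]; first by rewrite mul0r addr0.
  by rewrite -IHm -[RHS]circle_ptD2pi; congr circle_pt; ring.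
case: k => m; first exact: nat_case.
rewrite NegzE -(nat_case m.+1 (t + _)); congr circle_pt.
by rewrite mulrNz mulNr subrK.
Qed.

(** The angle [acos c] has cosine [c] and sine [|s|]; its opposite serves when [s] is negative. *)
Lemma circle_pt_surj p : circle p -> exists t, p = circle_pt t.
Proof.
case: p => c s; rewrite /circle /= => cs1.
have c2 : c ^+ 2 <= 1 by rewrite -cs1 lerDl sqr_ge0.
have c1 : -1 <= c <= 1 by rewrite -ler_norml -sqrtr_sqr -sqrtr1 ler_sqrt.
have sinc : sin (acos c) = `|s| by rewrite sin_acos // -cs1 addrC addKr sqrtr_sqr.
have cosc : cos (acos c) = c by rewrite acosK // in_itv.
case: (lerP 0 s) => s0.
  by exists (acos c); rewrite /circle_pt cosc sinc ger0_norm.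
by exists (- acos c); rewrite /circle_pt cosN sinN cosc sinc ltr0_norm // opprK.
Qed.

Lemma circle_pt_surj_from tau p :
  circle p -> exists2 t, tau <= t < tau + 2 * pi & p = circle_pt t.
Proof.
move=> /circle_pt_surj [t ->]; have pi0 := @pi_gt0 R.
have pi2 : 0 < 2 * pi :> R by lra.
pose k := Num.floor ((t - tau) / (2 * pi)).
exists (t + (- k)%:~R * (2 * pi)); last by rewrite circle_ptDz.
have := floor_itv ((t - tau) / (2 * pi)); rewrite -/k => /andP[].
rewrite ler_pdivlMr // ltr_pdivrMr // intrD mulrNz mulNr mulrDl mul1r; lra.
Qed.

(** The cosine of the difference is 1, so the sine of half the difference is 0; if that half were
    positive, it would lie strictly between 0 and [pi]. *)
Lemma circle_pt_inj t u :
  u - 2 * pi < t < u + 2 * pi -> circle_pt t = circle_pt u -> t = u.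
Proof.
wlog ut : t u / u <= t => [wlg b e|/andP[_ b] [ec es]].
  case: (lerP u t) => [|/ltW] h; first exact: wlg.
  by apply/esym/wlg => //; lra.
apply/eqP; rewrite eq_le ut andbT leNgt; apply/negP => ltut.
have sin0 : sin ((t - u) / 2) = 0.
  have : cos ((t - u) / 2 *+ 2) = 1.
    rewrite -mulr_natr divfK ?pnatr_eq0 // cosB ec es -!expr2; exact: cos2Dsin2.
  rewrite cos_mulr2n cos2sin2 => h; apply/eqP; rewrite -sqrf_eq0; apply/eqP; lra.
have : 0 < sin ((t - u) / 2) by apply: sin_gt0_pi; lra.
by rewrite sin0 ltxx.
Qed.

(** [ccw] leaves all three angles free; adding the same number of turns to each makes the first one
    the given [t]. *)
Lemma ccw_lift t p q : ccw (circle_pt t) p q <->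
  exists u v, [/\ p = circle_pt u, q = circle_pt v, t < u, u < v & v < t + 2 * pi].
Proof.
split=> [[t' [u [v [et -> -> [tu uv vt]]]]]|[u [v [-> -> tu uv vt]]]]; last first.
  by exists t, u, v.
have [k kP] : exists k : int, t = t' + k%:~R * (2 * pi).
  have pi2 : 0 < 2 * pi :> R by have := @pi_gt0 R; lra.
  pose k := Num.floor ((t - t') / (2 * pi)).
  exists k; apply: circle_pt_inj; last by rewrite circle_ptDz.
  have := floor_itv ((t - t') / (2 * pi)); rewrite -/k => /andP[].
  rewrite ler_pdivlMr // ltr_pdivrMr // intrD mulrDl mul1r; lra.
exists (u + k%:~R * (2 * pi)), (v + k%:~R * (2 * pi)).
rewrite !circle_ptDz kP; split=> //; lra.
Qed.

Lemma ccw_window t v p : t < v < t + 2 * pi ->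
  ccw (circle_pt t) p (circle_pt v) <-> exists2 u, t < u < v & p = circle_pt u.
Proof.
move=> tv; split=> [/ccw_lift[u [v' [-> ev tu uv vt]]]|[u tuv ->]].
  exists u => //; suff -> : v = v' by lra.
  by apply: circle_pt_inj => //; lra.
by apply/ccw_lift; exists u, v; split=> //; lra.
Qed.

(** This reduces the cyclic order to linear arithmetic. Angles lifted from [t] that pass
    [tau + 2 * pi] are brought back by one turn, which yields the rotated alternatives. *)
Lemma ccw_cyc tau t u v : tau <= t < tau + 2 * pi ->
  tau <= u < tau + 2 * pi -> tau <= v < tau + 2 * pi ->
  ccw (circle_pt t) (circle_pt u) (circle_pt v) <->
  [|| t < u < v, u < v < t | v < t < u].
Proof.
move=> ti ui vi; split=> [/ccw_lift[u' [v' [eu ev tu uv vt]]]|].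
  have [lu|gu] := ltP u' (tau + 2 * pi).
    have eu' : u = u' by apply: circle_pt_inj => //; lra.
    have [lv|gv] := ltP v' (tau + 2 * pi).
      have ev' : v = v' by apply: circle_pt_inj => //; lra.
      lra.
    have ev' : v = v' - 2 * pi.
      by apply: circle_pt_inj; [lra|rewrite circle_ptB2pi].
    lra.
  have eu' : u = u' - 2 * pi.
    by apply: circle_pt_inj; [lra|rewrite circle_ptB2pi].
  have ev' : v = v' - 2 * pi.
    by apply: circle_pt_inj; [lra|rewrite circle_ptB2pi].
  lra.
move=> /or3P[] h; apply/ccw_lift.
- by exists u, v; split=> //; lra.
- by exists (u + 2 * pi), (v + 2 * pi); rewrite !circle_ptD2pi; split=> //; lra.
- by exists u, (v + 2 * pi); rewrite !circle_ptD2pi; split=> //; lra.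
Qed.

Lemma continuous_circle_pt : continuous (@circle_pt R).
Proof.
move=> t; have c := @continuous_cos R t; have s := @continuous_sin R t.
exact: cvg_pair c s.
Qed.

Lemma closed_circle : closed (@circle R).
Proof.
apply: (@preimage_closed _ _ (fun p : R * R => p.1 ^+ 2 + p.2 ^+ 2) [set 1]) => //.
move=> p _; apply: (@cvgD R R^o).
  apply: (@continuous_comp _ _ _ fst (fun x : R => x ^+ 2)); first exact: cvg_fst.
  exact: exprn_continuous.
apply: (@continuous_comp _ _ _ snd (fun x : R => x ^+ 2)); first exact: cvg_snd.
exact: exprn_continuous.
Qed.

End Circle.

(** * Angles of the limit points and of the points of Z *)

(* [lo i] and [hi i] are angles of a_i and a_(i+1), all within one turn from
   [tau]; the second one is [tau + 2 * pi] rather than [tau] for the last i. *)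
Record angles (R : realType) (n : nat) (a : 'I_n -> R * R) (tau : R)
    (lo hi : 'I_n -> R) : Prop := Angles {
  angles_lo : forall i, a i = circle_pt (lo i);
  angles_hi : forall i, a (ordS i) = circle_pt (hi i);
  angles_lt : forall i, lo i < hi i;
  angles_ge : forall i, tau <= lo i;
  angles_le : forall i, hi i <= tau + 2 * pi;
  angles_turn : forall i, hi i < lo i + 2 * pi;
  angles_order : forall i j : 'I_n, (i < j)%N -> hi i <= lo j;
  angles_cover : forall t, tau <= t < tau + 2 * pi -> exists i, lo i <= t < hi i
}.

(** [tau] is the angle of the first limit point, and the others are measured in the turn that starts
    there; the orientation of triples through the first point makes them increase. *)
Lemma limit_points_angles (R : realType) (Z : set (R * R)) n (a : 'I_n -> R * R) :
  (2 <= n)%N -> Z `<=` @circle R -> limit_points Z a ->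
  exists tau lo hi, angles a tau lo hi.
Proof.
case: n a => // -[//|n] a _ Zc [inja rga orda].
have ca i : circle (a i).
  have [cl _] : limit_set Z (a i) by rewrite -rga; exists i.
  by rewrite ((closure_id _).1 (@closed_circle R)); exact: closureS cl.
have [tau _ a0] := circle_pt_surj_from 0 (ca ord0).
have f i := cid2 (circle_pt_surj_from tau (ca i)).
pose lo i := sval (f i).
have lo_itv i : tau <= lo i < tau + 2 * pi by exact: s2valP (f i).
have lo_a i : a i = circle_pt (lo i) by exact: s2valP' (f i).
have pi0 := @pi_gt0 R.
have lo0 : lo ord0 = tau.
  by apply: circle_pt_inj; [have := lo_itv ord0; lra | rewrite -lo_a -a0].
have lo_gt0 (j : 'I_n.+2) : (0 < j)%N -> tau < lo j.
  move=> j0; have := lo_itv j; rewrite le_eqVlt => /andP[/orP[/eqP e|//] _].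
  have : a j = a ord0 by rewrite lo_a -e a0.
  by move/inja => e'; rewrite e' in j0.
have lo_lt (i j : 'I_n.+2) : (i < j)%N -> lo i < lo j.
  have [i0 ij|i0 ij] := posnP i.
    have -> : i = ord0 by apply: val_inj.
    by rewrite lo0; apply: lo_gt0; exact: leq_ltn_trans ij.
  have := orda ord0 i j i0 ij; rewrite !lo_a lo0.
  have := lo_gt0 _ i0; have iti := lo_itv i; have itj := lo_itv j => ti.
  by rewrite (@ccw_cyc _ tau) //; lra.
pose hi (i : 'I_n.+2) := if (i.+1 < n.+2)%N then lo (ordS i) else tau + 2 * pi.
have ordSE (i : 'I_n.+2) : (i.+1 < n.+2)%N -> ordS i = i.+1 :> nat.
  by move=> h; rewrite /= modn_small.
have ordSE' (i : 'I_n.+2) : ~~ (i.+1 < n.+2)%N -> ordS i = ord0.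
  rewrite -leqNgt => h; apply: val_inj => /=.
  by have /eqP -> : i.+1 == n.+2; [rewrite eqn_leq h ltn_ord | rewrite modnn].
exists tau, lo, hi; split=> //.
- move=> i; rewrite /hi; case: ifPn => [_ //|/ordSE' ->].
  by rewrite circle_ptD2pi lo_a lo0.
- move=> i; rewrite /hi; case: ifPn => [h|_]; first by apply: lo_lt; rewrite ordSE.
  by have := lo_itv i; lra.
- by move=> i; have := lo_itv i; lra.
- move=> i; rewrite /hi; case: ifPn => [h|_]; last lra.
  by have := lo_itv (ordS i); lra.
- move=> i; rewrite /hi; case: ifPn => [h|h].
    by have := lo_itv (ordS i); have := lo_itv i; lra.
  (* Here [i] is the last index, which is not 0 because there are at least two limit points. *)
  suff : tau < lo i by lra.
  by apply: lo_gt0; move: h; case: (nat_of_ord i).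
- move=> i j ij; rewrite /hi; case: ifPn => [h|]; last by have := ltn_ord j; lia.
  have := ordSE i h; have [|] := ltnP i.+1 j.
    by move=> h1 h2; apply/ltW/lo_lt; rewrite h2.
  move=> h1 h2; rewrite (_ : ordS i = j) //; apply/val_inj/eqP.
    by rewrite eqn_leq [val _]h2 h1 ij.
move=> t ti.
have P0 : lo ord0 <= t by rewrite lo0; lra.
(* The interval containing [t] starts at the last limit angle not exceeding [t]. *)
case: (@arg_maxnP _ ord0 (fun i => lo i <= t) (fun i => nat_of_ord i) P0) => i lit maxi.
exists i; rewrite lit /= /hi; case: ifPn => [h|_]; last lra.
rewrite ltNge; apply/negP => /maxi; rewrite ordSE //; lia.
Qed.

(** * The discrete chains of Z between consecutive limit points *)

Section AdmissibleSets.
Variables (R : realType) (Z : set (R * R)) (n : nat) (a : 'I_n -> R * R).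
Variables (tau : R) (lo hi : 'I_n -> R).
Hypotheses (hZ : admissible Z) (ha : limit_points Z a) (hA : angles a tau lo hi).
Implicit Types (i j : 'I_n) (t u v : R).

Definition zangles i : set R := [set t | lo i < t < hi i /\ Z (circle_pt t)].

Let loP := angles_lo hA.
Let hiP := angles_hi hA.
Let lo_lt_hi := angles_lt hA.
Let tau_lo := angles_ge hA.
Let hi_tau := angles_le hA.
Let hi_order := angles_order hA.

Lemma zangles_Z i t : zangles i t -> Z (circle_pt t).
Proof. by case. Qed.

Lemma zangles_turn i t : zangles i t -> tau < t < tau + 2 * pi.
Proof. by move=> [+ _]; have := tau_lo i; have := hi_tau i; lra. Qed.

Lemma angles_itv_inj i j t : lo i <= t < hi i -> lo j <= t < hi j -> i = j.
Proof.
move=> ti tj; apply: val_inj; by case: (ltngtP i j) => // /hi_order h; exfalso; lra.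
Qed.

Lemma zangles_inj i j t u : zangles i t -> zangles j u ->
  circle_pt t = circle_pt u -> i = j /\ t = u.
Proof.
move=> ti uj e; have tu : t = u.
  by apply: circle_pt_inj e; have := zangles_turn ti; have := zangles_turn uj; lra.
split=> //; apply: (angles_itv_inj (t := t)); first by case: ti; lra.
by rewrite tu; case: uj; lra.
Qed.

Lemma limit_set_range i : limit_set Z (a i).
Proof. by case: ha => _ <- _; exists i. Qed.

Lemma circle_pt_limit i t : lo i < t < hi i -> ~ limit_set Z (circle_pt t).
Proof.
move=> ti; case: (ha) => _ <- _ [j _]; rewrite loP => e.
have et : lo j = t.
  apply: circle_pt_inj e; have := tau_lo i; have := hi_tau i; have := tau_lo j.
  by have := hi_tau j; have := lo_lt_hi j; lra.
have ij : i = j.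
  by apply: (angles_itv_inj (t := t)); have := lo_lt_hi j; lra.
by move: ti; rewrite -et ij; lra.
Qed.

Lemma zangles_exists p : Z p -> exists i t, p = circle_pt t /\ zangles i t.
Proof.
move=> Zp; have [Zc _ _ _ _] := hZ.
have [t ti pt] := circle_pt_surj_from tau (Zc p Zp).
have [i it] := angles_cover hA ti; exists i, t; split=> //; split; last by rewrite -pt.
have [e|] := eqVneq (lo i) t; last lra.
by have [_] := limit_set_range i; rewrite loP e -pt.
Qed.

(** A point of Z is isolated, and any other point here is outside the closure of Z, as no limit
    point lies strictly inside the interval. Continuity of [circle_pt] transfers the neighbourhood
    to angles. *)
Lemma zangles_isolated i t : lo i < t < hi i ->
  exists2 e : R, 0 < e & forall u, zangles i u -> `|t - u| < e -> u = t.
Proof.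
move=> ti; have [V Vt VZ] : exists2 V, nbhs (circle_pt t) V &
    forall p, V p -> Z p -> p = circle_pt t.
  have [Zt|nZt] := pselect (Z (circle_pt t)).
    have [_ iZ _ _ _] := hZ; have [_ [V Vt VZ]] := iZ _ Zt; exists V => // p Vp Zp.
    by have : (V `&` Z) p by []; rewrite VZ.
  have : ~ closure Z (circle_pt t) by move=> clt; exact: (circle_pt_limit ti).
  move/existsNP => [V /not_implyP [Vt /nonemptyPn VZ]]; exists V => // p Vp Zp.
  by have : (Z `&` V) p by []; rewrite VZ.
have /nbhs_ballP[e /= e0 eV] := continuous_circle_pt Vt.
exists e => // u ui ue; have := VZ _ (eV u ue) (zangles_Z ui) => eut.
apply: circle_pt_inj eut; have := zangles_turn ui.
by have := tau_lo i; have := hi_tau i; lra.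
Qed.

(** The bound [c] keeps the infimum strictly inside the interval, where isolation forces nearby
    elements of [E] to equal it. *)
Lemma zangles_min i (E : set R) c : E `<=` zangles i -> E !=set0 -> lo i < c ->
  (forall t, E t -> c <= t) -> exists2 m, E m & forall t, E t -> m <= t.
Proof.
move=> Ei E0 ci cE; have [t0 Et0] := E0.
have lbE : has_lbound E by exists c.
have infE : has_inf E by [].
have cinf : c <= inf E by apply: lb_le_inf.
have inf_le t : E t -> inf E <= t by apply: ge_inf.
have [t0i _] := Ei _ Et0.
have infi : lo i < inf E < hi i by have := inf_le _ Et0; lra.
have [e e0 he] := zangles_isolated infi.
have [t Et te] := inf_adherent e0 infE.
have eqt : t = inf E.
  by apply: he; [exact: Ei | rewrite ltr_norml; have := inf_le _ Et; lra].
by exists t => // u /inf_le; rewrite eqt.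
Qed.

Lemma zangles_max i (E : set R) c : E `<=` zangles i -> E !=set0 -> c < hi i ->
  (forall t, E t -> t <= c) -> exists2 m, E m & forall t, E t -> t <= m.
Proof.
move=> Ei E0 ci cE; have [t0 Et0] := E0.
have ubE : has_ubound E by exists c.
have supE : has_sup E by [].
have csup : sup E <= c by apply: ge_sup.
have le_sup t : E t -> t <= sup E by apply: ub_le_sup.
have [t0i _] := Ei _ Et0.
have supi : lo i < sup E < hi i by have := le_sup _ Et0; lra.
have [e e0 he] := zangles_isolated supi.
have [t Et te] := sup_adherent e0 supE.
have eqt : t = sup E.
  by apply: he; [exact: Ei | rewrite ltr_norml; have := le_sup _ Et; lra].
by exists t => // u /le_sup; rewrite eqt.
Qed.

Lemma zangles_near_lo i c : lo i < c -> exists2 t, zangles i t & t < c.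
Proof.
move=> ic; have [_ _ _ _ two] := hZ.
have e0 : 0 < Num.min c (hi i) - lo i by rewrite subr_gt0 lt_min ic lo_lt_hi.
have [_ [t ti Zt]] := two _ (limit_set_range i) _ _ (loP i) e0.
move: ti; rewrite addrC subrK lt_min => /and3P[h1 h2 h3].
by exists t => //; split=> //; rewrite h1 h3.
Qed.

Lemma zangles_near_hi i c : c < hi i -> exists2 t, zangles i t & c < t.
Proof.
move=> ic; have [_ _ _ _ two] := hZ.
have e0 : 0 < hi i - Num.max c (lo i) by rewrite subr_gt0 gt_max ic lo_lt_hi.
have [[t ti Zt] _] := two _ (limit_set_range (ordS i)) _ _ (hiP i) e0.
move: ti; rewrite opprB addrC subrK gt_max => /andP[/andP[h1 h2] h3].
by exists t => //; split=> //; rewrite h2 h3.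
Qed.

Lemma ccw_zangles i j k t u v : zangles i t -> zangles j u -> zangles k v ->
  ccw (circle_pt t) (circle_pt u) (circle_pt v) <->
  [|| t < u < v, u < v < t | v < t < u].
Proof.
move=> /zangles_turn ti /zangles_turn uj /zangles_turn vk.
by apply: (@ccw_cyc _ tau); lra.
Qed.

(** Any other candidate for the neighbour would either lie between the two points or have the
    claimed neighbour in between. *)
Lemma zsucc_adjacent i t u : zangles i t -> zangles i u -> t < u ->
  (forall v, zangles i v -> ~ (t < v < u)) ->
  zsucc Z (circle_pt t) = circle_pt u /\ zpred Z (circle_pt u) = circle_pt t.
Proof.
move=> ti ui tu gap.
have gapZ c : Z c -> ~ ccw (circle_pt t) c (circle_pt u).
  move=> /zangles_exists[j [v [-> vj]]] /(ccw_zangles ti vj ui) h.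
  have tvu : t < v < u by lra.
  have ij : i = j.
    by apply: (angles_itv_inj (t := v)); case: ti; case: ui; case: vj; lra.
  by apply: (gap v) => //; rewrite ij.
have neq : circle_pt u <> circle_pt t.
  by move=> e; have [_] := zangles_inj ui ti e; lra.
split; apply: xget_unique.
- by split=> //; exact: zangles_Z ui.
- move=> _ [/zangles_exists[j [v [-> vj]]] vt vmin].
  congr circle_pt; apply/eqP; have [//|uv] := eqVneq v u.
  have {vt} vt : v != t by apply: contra_notN vt => /eqP ->.
  have := gapZ _ (zangles_Z vj); rewrite (ccw_zangles ti vj ui).
  have := vmin _ (zangles_Z ui); rewrite (ccw_zangles ti ui vj); lra.
- by split=> //; [exact: zangles_Z ti | exact/nesym].
- move=> _ [/zangles_exists[j [v [-> vj]]] vu vmin].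
  congr circle_pt; apply/eqP; have [//|vt] := eqVneq v t.
  have {vu} vu : v != u by apply: contra_notN vu => /eqP ->.
  have := gapZ _ (zangles_Z vj); rewrite (ccw_zangles ti vj ui).
  have := vmin _ (zangles_Z ti); rewrite (ccw_zangles vj ti ui); lra.
Qed.

(** The successor is the least angle of Z above [t] in the interval; there are such angles because Z
    accumulates at [hi i]. *)
Lemma zsucc_zangles i t : zangles i t ->
  exists u, [/\ zangles i u, t < u, zsucc Z (circle_pt t) = circle_pt u
              & zpred Z (circle_pt u) = circle_pt t].
Proof.
move=> ti; have [/andP[tl th] _] := ti; have [u0 u0i tu0] := zangles_near_hi th.
have [u [ui tu] minu] : exists2 u, zangles i u /\ t < u &
    forall v, zangles i v /\ t < v -> u <= v.
  apply: (@zangles_min i [set v | zangles i v /\ t < v] t) => //.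
  - by move=> v [].
  - by exists u0.
  - by move=> v [_ /ltW].
have [|e1 e2] := zsucc_adjacent ti ui tu; last by exists u.
move=> v vi /andP[tv]; rewrite ltNge => /negP; apply; exact: minu.
Qed.

Lemma zpred_zangles i t : zangles i t ->
  exists u, [/\ zangles i u, u < t, zpred Z (circle_pt t) = circle_pt u
              & zsucc Z (circle_pt u) = circle_pt t].
Proof.
move=> ti; have [/andP[tl th] _] := ti; have [u0 u0i tu0] := zangles_near_lo tl.
have [u [ui tu] maxu] : exists2 u, zangles i u /\ u < t &
    forall v, zangles i v /\ v < t -> v <= u.
  apply: (@zangles_max i [set v | zangles i v /\ v < t] t) => //.
  - by move=> v [].
  - by exists u0.
  - by move=> v [_ /ltW].
have [|e1 e2] := zsucc_adjacent ui ti tu; last by exists u.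
move=> v vi /andP[uv vt]; move: uv; rewrite ltNge => /negP; apply; exact: maxu.
Qed.

Lemma zsucc_Z p : Z p -> Z (zsucc Z p).
Proof.
by move=> /zangles_exists[i [t [-> /zsucc_zangles[u [ui _ -> _]]]]]; exact: zangles_Z ui.
Qed.

Lemma zpred_Z p : Z p -> Z (zpred Z p).
Proof.
by move=> /zangles_exists[i [t [-> /zpred_zangles[u [ui _ -> _]]]]]; exact: zangles_Z ui.
Qed.

Lemma zsuccK p : Z p -> zpred Z (zsucc Z p) = p.
Proof. by move=> /zangles_exists[i [t [-> /zsucc_zangles[u [_ _ -> ->]]]]]. Qed.

Lemma zpredK p : Z p -> zsucc Z (zpred Z p) = p.
Proof. by move=> /zangles_exists[i [t [-> /zpred_zangles[u [_ _ -> ->]]]]]. Qed.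

Lemma iter_zsucc_zangles i t k : zangles i t ->
  exists2 u, zangles i u & iter k (zsucc Z) (circle_pt t) = circle_pt u.
Proof.
move=> ti; elim: k => [|k [u ui e]]; first by exists t.
by have [v [vi _ e' _]] := zsucc_zangles ui; exists v => //=; rewrite e.
Qed.

Lemma iter_zpred_zangles i t k : zangles i t ->
  exists2 u, zangles i u & iter k (zpred Z) (circle_pt t) = circle_pt u.
Proof.
move=> ti; elim: k => [|k [u ui e]]; first by exists t.
by have [v [vi _ e' _]] := zpred_zangles ui; exists v => //=; rewrite e.
Qed.

(** The angles of the iterates strictly decrease. If all exceeded [c], there would be a least one,
    which the next iterate undercuts. Covering all large [l] allows both endpoints of an arc to be
    treated at once. *)
Lemma iter_zpred_below i t c : zangles i t -> lo i < c ->
  exists k, forall l, (k <= l)%N -> exists u, [/\ zangles i u, u <= c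
    & iter l (zpred Z) (circle_pt t) = circle_pt u].
Proof.
move=> ti ic; have f l := cid2 (iter_zpred_zangles l ti).
pose g l := sval (f l).
have gi l : zangles i (g l) by exact: s2valP (f l).
have ge l : iter l (zpred Z) (circle_pt t) = circle_pt (g l) by exact: s2valP' (f l).
have gS l : g l.+1 < g l.
  have [u [ui ul eu _]] := zpred_zangles (gi l).
  have [//|_ ->//] := zangles_inj (gi l.+1) ui; by rewrite -ge /= ge.
have gmono k l : (k <= l)%N -> g l <= g k.
  move=> /subnK <-; elim: (l - k)%N => [|m IHm]; first by rewrite add0n.
  by rewrite addSn; apply: le_trans IHm; exact/ltW.
have [k gk] : exists k, g k <= c.
  apply: contrapT => /forallNP gc.
  have [m [l _ <-] minm] : exists2 m, range g m & forall u, range g u -> m <= u.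
    apply: (@zangles_min i _ c) => //; [by move=> _ [l _ <-]|by exists (g 0%N), 0%N|].
    by move=> _ [l _ <-]; apply/ltW; rewrite ltNge; apply/negP/gc.
  by have := minm (g l.+1) (imageT _ _); rewrite leNgt gS.
by exists k => l kl; exists (g l); split=> //; exact: le_trans (gmono _ _ kl) gk.
Qed.

Lemma iter_zsucc_above i t c : zangles i t -> c < hi i ->
  exists k, forall l, (k <= l)%N -> exists u, [/\ zangles i u, c < u
    & iter l (zsucc Z) (circle_pt t) = circle_pt u].
Proof.
move=> ti ic; have f l := cid2 (iter_zsucc_zangles l ti).
pose g l := sval (f l).
have gi l : zangles i (g l) by exact: s2valP (f l).
have ge l : iter l (zsucc Z) (circle_pt t) = circle_pt (g l) by exact: s2valP' (f l).
have gS l : g l < g l.+1.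
  have [u [ui ul eu _]] := zsucc_zangles (gi l).
  have [//|_ ->//] := zangles_inj (gi l.+1) ui; by rewrite -ge /= ge.
have gmono k l : (k <= l)%N -> g k <= g l.
  move=> /subnK <-; elim: (l - k)%N => [|m IHm]; first by rewrite add0n.
  by rewrite addSn; apply: le_trans IHm _; exact/ltW.
have [k gk] : exists k, c < g k.
  apply: contrapT => /forallNP gc.
  have [m [l _ <-] maxm] : exists2 m, range g m & forall u, range g u -> u <= m.
    apply: (@zangles_max i _ c) => //; [by move=> _ [l _ <-]|by exists (g 0%N), 0%N|].
    by move=> _ [l _ <-]; rewrite leNgt; apply/negP/gc.
  by have := maxm (g l.+1) (imageT _ _); rewrite leNgt gS.
by exists k => l kl; exists (g l); split=> //; exact: lt_le_trans gk (gmono _ _ kl).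
Qed.

(** [is_arc] does not say which endpoint comes first; exchanging them is harmless since [zsucc] and
    [zpred] are mutually inverse on Z. *)
Lemma is_arc_pair p q : is_arc Z [set p; q] <->
  [/\ Z p, Z q, q <> zpred Z p, q <> p & q <> zsucc Z p].
Proof.
split=> [|[Zp Zq h1 h2 h3]]; last by exists p, q.
move=> [p' [q' [Zp Zq [h1 h2 h3] e]]].
have p'pq : [set p; q] p' by rewrite e; left.
have q'pq : [set p; q] q' by rewrite e; right.
case: p'pq => /= ep; case: q'pq => /= eq; subst p' q' => //; split=> //.
- by move=> eq; apply: h3; rewrite eq zpredK.
- exact/nesym.
- by move=> eq; apply: h1; rewrite eq zsuccK.
Qed.

Lemma is_arc_zpred p q : is_arc Z [set p; q] ->
  is_arc Z [set zpred Z p; zpred Z q].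
Proof.
move=> /is_arc_pair[Zp Zq h1 h2 h3]; apply/is_arc_pair.
split; [exact: zpred_Z|exact: zpred_Z| | |].
- by move/(congr1 (zsucc Z)); rewrite !zpredK //; exact: zpred_Z.
- by move/(congr1 (zsucc Z)); rewrite !zpredK.
- by rewrite zpredK // => /(congr1 (zsucc Z)); rewrite zpredK.
Qed.

Lemma is_arc_zsucc p q : is_arc Z [set p; q] ->
  is_arc Z [set zsucc Z p; zsucc Z q].
Proof.
move=> /is_arc_pair[Zp Zq h1 h2 h3]; apply/is_arc_pair.
split; [exact: zsucc_Z|exact: zsucc_Z| | |].
- by rewrite zsuccK // => /(congr1 (zpred Z)); rewrite zsuccK.
- by move/(congr1 (zpred Z)); rewrite !zsuccK.
- by move/(congr1 (zpred Z)); rewrite !zsuccK //; exact: zsucc_Z.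
Qed.

End AdmissibleSets.

(** * Arcs, crossings and decorations in terms of angles *)

Section Arcs.
Variables (R : realType) (Z : set (R * R)) (n : nat) (a : 'I_n -> R * R).
Variables (tau : R) (lo hi : 'I_n -> R).
Hypotheses (hZ : admissible Z) (ha : limit_points Z a) (hA : angles a tau lo hi).
Implicit Types (i j : 'I_n) (t u v : R).
Local Notation zangles := (zangles Z lo hi).

(** Both neighbours of a point of Z lie in the interval of that point. *)
Lemma is_arc_zangles i j t u : i <> j -> zangles i t -> zangles j u ->
  is_arc Z [set circle_pt t; circle_pt u].
Proof.
move=> ij ti uj; apply/(is_arc_pair hZ ha hA).
have [v [vi _ ev _]] := zpred_zangles hZ ha hA ti.
have [w [wi _ ew _]] := zsucc_zangles hZ ha hA ti.
have neq s : zangles i s -> circle_pt u <> circle_pt s.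
  by move=> si /esym /(zangles_inj hA si uj) [].
by rewrite ev ew; split; [exact: zangles_Z ti|exact: zangles_Z uj|exact: neq..].
Qed.

(** The intervals are disjoint, so both angles in one precede both angles in the other. *)
Lemma cross_zangles i j t t' u u' : i <> j -> zangles i t -> zangles i t' ->
  zangles j u -> zangles j u' -> t < t' -> u < u' ->
  cross [set circle_pt t; circle_pt u] [set circle_pt t'; circle_pt u'].
Proof.
move=> ij ti ti' uj uj' tt' uu'.
exists (circle_pt t), (circle_pt u), (circle_pt t'), (circle_pt u'); split=> //; left.
have : t' < u \/ u' < t.
  case: (ti) (ti') (uj) (uj') => /andP[t1 t2] _ [/andP[t3 t4] _].
  move=> [/andP[t5 t6] _] [/andP[t7 t8] _].
  case: (ltngtP i j) => [/(angles_order hA) h|/(angles_order hA) h|/val_inj //].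
    by left; lra.
  by right; lra.
move=> d; split; rewrite ((ccw_zangles hA ti ti' uj), (ccw_zangles hA ti' uj uj'),
  (ccw_zangles hA uj uj' ti), (ccw_zangles hA uj' ti ti')); lra.
Qed.

(** One side of the first arc meets Z only in the segment from [lo i] to [c], and a crossing arc has
    an endpoint on each side. *)
Lemma not_cross_zangles i j k c t t' u v :
  zangles i t -> zangles i t' -> t <= c -> t' <= c ->
  zangles j u -> zangles k v -> ~ (lo i < u <= c) -> ~ (lo i < v <= c) ->
  ~ cross [set circle_pt t; circle_pt t'] [set circle_pt u; circle_pt v].
Proof.
move=> ti ti' tc tc' uj vk ujc vkc [x0 [x1 [y0 [y1 [ex ey]]]]].
have x_in x : [set x0; x1] x -> exists s, [/\ x = circle_pt s, zangles i s & s <= c].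
  by rewrite -ex => -[] ->; [exists t|exists t'].
have y_in y : [set y0; y1] y ->
    exists l s, [/\ y = circle_pt s, zangles l s & ~ (lo i < s <= c)].
  by rewrite -ey => -[] ->; [exists j, u|exists k, v].
have [s0 [e0 s0i s0c]] : exists s, [/\ x0 = circle_pt s, zangles i s & s <= c].
  by apply: x_in; left.
have [s1 [e1 s1i s1c]] : exists s, [/\ x1 = circle_pt s, zangles i s & s <= c].
  by apply: x_in; right.
have sep y y' : [set y0; y1] y -> [set y0; y1] y' -> ccw x0 y x1 -> ccw x1 y' x0 -> False.
  move=> /y_in[l [r [-> rl rc]]] /y_in[l' [r' [-> rl' rc']]].
  rewrite e0 e1 (ccw_zangles hA s0i rl s1i) (ccw_zangles hA s1i rl' s0i).
  by have [/andP[? ?] _] := s0i; have [/andP[? ?] _] := s1i; lra.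
case=> -[h1 _ h2 _]; first by apply: (sep _ _ _ _ h1 h2); [left|right].
by apply: (sep _ _ _ _ h1 h2); [right|left].
Qed.

Lemma itv_oc_zangles i j c t : lo i < c <= hi i -> zangles j t ->
  itv_oc Z (a i) (circle_pt c) (circle_pt t) <-> lo i < t <= c.
Proof.
move=> ic tj; have tt := zangles_turn hA tj; rewrite (angles_lo hA).
have tau1 := angles_ge hA i; have tau2 := angles_le hA i; have tau3 := angles_turn hA i.
have tc : lo i < c < lo i + 2 * pi by lra.
split=> [[_ [_ [e|/(ccw_window _ tc) [u uc e]]]]|h].
- have -> : t = c by apply: circle_pt_inj e; lra.
  lra.
- have -> : t = u by apply: circle_pt_inj e; lra.
  lra.
split; first by apply: subset_closure; exact: zangles_Z tj.
split; first by move=> e; have := circle_pt_inj _ e; lra.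
have [->|ntc] := eqVneq t c; [by left|right].
by apply/(ccw_window _ tc); exists t => //; lra.
Qed.

(** The angle [xi i] is [lo i] when x_i is a_i, and [hi i] when x_i is a_(i+1). The first is
    possible only for singletons, the second never for them. *)
Lemma decoration_angles (P : {set {set 'I_n}}) (x : 'I_n -> R * R) :
  decoration Z a P x -> exists xi : 'I_n -> R, forall i,
    [/\ xi i <= hi i, singleton_of P i -> xi i < hi i,
        ~ singleton_of P i -> lo i < xi i & forall j t, zangles j t ->
          itv_oc Z (a i) (x i) (circle_pt t) <-> lo i < t <= xi i].
Proof.
move=> dec; suff h i : exists c,
    [/\ c <= hi i, singleton_of P i -> c < hi i, ~ singleton_of P i -> lo i < c
      & forall j t, zangles j t ->
          itv_oc Z (a i) (x i) (circle_pt t) <-> lo i < t <= c].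
  have f i := cid (h i); exists (fun i => sval (f i)) => i; exact: svalP (f i).
have [sng adj oth] := dec i.
have turn : lo i < hi i < lo i + 2 * pi by rewrite (angles_lt hA) (angles_turn hA).
have inner : ccw (a i) (x i) (a (ordS i)) -> exists c,
    [/\ c <= hi i, singleton_of P i -> c < hi i, ~ singleton_of P i -> lo i < c
      & forall j t, zangles j t ->
          itv_oc Z (a i) (x i) (circle_pt t) <-> lo i < t <= c].
  rewrite (angles_lo hA) (angles_hi hA) => /(ccw_window _ turn)[c ci ->].
  exists c; split; [by lra|by move=> _; lra|by move=> _; lra|].
  move=> j t tj; rewrite -(angles_lo hA).
  by apply: (itv_oc_zangles _ tj); lra.
have [s|ns] := pselect (singleton_of P i).
  have [_ [_ [e|]]] := sng s; last exact: inner.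
  exists (lo i); rewrite e; split=> //; [by lra|by move=> _; lra|].
  by move=> j t _; split=> [[_ [//]]|]; lra.
have [s|na] := pselect (adjacency_of P i).
  have [_ [_ [e|]]] := adj s; last exact: inner.
  exists (hi i); rewrite e; split=> //; first by move=> _; lra.
  move=> j t tj; rewrite (angles_hi hA); apply: (itv_oc_zangles _ tj); lra.
by have [_ /inner] := oth ns na.
Qed.

End Arcs.

(** * Krull-Schmidt categories and torsion pairs *)

Section LinearCategories.
Variables (K : fieldType) (T : linear_category K).
Implicit Types A B C D : T.

Lemma compDl A B C (f : hom T A B) (g h : hom T B C) :
  (g + h) ∘ f = g ∘ f + h ∘ f.
Proof. by have := comp_linearl f 1 g h; rewrite /= !scale1r. Qed.

Lemma compDr A B C (g : hom T B C) (f h : hom T A B) :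
  g ∘ (f + h) = g ∘ f + g ∘ h.
Proof. by have := comp_linearr g 1 f h; rewrite /= !scale1r. Qed.

Lemma comp0l A B C (f : hom T A B) : (0 : hom T B C) ∘ f = 0.
Proof. by apply: (addIr (0 ∘ f)); rewrite -compDl !add0r. Qed.

Lemma comp0r A B C (g : hom T B C) : g ∘ (0 : hom T A B) = 0.
Proof. by apply: (addIr (g ∘ 0)); rewrite -compDr !add0r. Qed.

Lemma compNl A B C (f : hom T A B) (g : hom T B C) : (- g) ∘ f = - (g ∘ f).
Proof. by apply: (addIr (g ∘ f)); rewrite -compDl !addNr comp0l. Qed.

Lemma compNr A B C (f : hom T A B) (g : hom T B C) : g ∘ (- f) = - (g ∘ f).
Proof. by apply: (addIr (g ∘ f)); rewrite -compDr !addNr comp0r. Qed.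

Lemma comp_suml A B C (f : hom T A B) (I : finType) (g : I -> hom T B C) :
  (\sum_i g i) ∘ f = \sum_i (g i ∘ f).
Proof. exact: (big_morph (fun g => g ∘ f) (compDl f) (comp0l C f)). Qed.

Lemma comp_sumr A B C (g : hom T B C) (I : finType) (f : I -> hom T A B) :
  g ∘ (\sum_i f i) = \sum_i (g ∘ f i).
Proof. exact: (big_morph (fun f => g ∘ f) (compDr g) (comp0r A g)). Qed.

Lemma is_iso_id A : is_iso (idm A).
Proof. by exists (idm A); rewrite comp_idl. Qed.

Lemma is_iso_comp A B C (g : hom T B C) (f : hom T A B) :
  is_iso g -> is_iso f -> is_iso (g ∘ f).
Proof.
move=> [g' [g'g gg']] [f' [f'f ff']]; exists (f' ∘ g'); split.
  by rewrite compA -[f' ∘ g' ∘ g]compA g'g comp_idr f'f.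
by rewrite compA -[g ∘ f ∘ f']compA ff' comp_idr gg'.
Qed.

Lemma isomorphic_refl A : isomorphic A A.
Proof. by exists (idm A); exact: is_iso_id. Qed.

Lemma isomorphic_sym A B : isomorphic A B -> isomorphic B A.
Proof. by move=> [f [g [gf fg]]]; exists g, f. Qed.

Lemma isomorphic_trans B A C : isomorphic A B -> isomorphic B C -> isomorphic A C.
Proof. by move=> [f hf] [g hg]; exists (g ∘ f); apply: is_iso_comp. Qed.

Lemma is_zeroP A : is_zero A <-> idm A = 0.
Proof.
split=> [zA|e B]; [exact: (zA A).1 | split=> f].
  by rewrite -[f]comp_idr e comp0r.
by rewrite -[f]comp_idl e comp0l.
Qed.

Lemma isomorphic_zero A B : isomorphic A B -> is_zero A -> is_zero B.
Proof.
move=> [f [g [gf fg]]] zA; apply/is_zeroP.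
by rewrite -fg ((zA B).1 f) comp0l.
Qed.

(** Plays the role of a direct summand without a chosen complement. *)
Definition retract A B :=
  exists (u : hom T A B) (v : hom T B A), v ∘ u = idm A.

Lemma isomorphic_retract A B : isomorphic A B -> retract A B.
Proof. by move=> [f [g [gf _]]]; exists f, g. Qed.

Lemma retract_trans B A C : retract A B -> retract B C -> retract A C.
Proof.
move=> [u [v vu]] [u' [v' vu']]; exists (u' ∘ u), (v ∘ v').
by rewrite compA -[v ∘ v' ∘ u']compA vu' comp_idr.
Qed.

(** The idempotent [u ∘ v] is the identity if it is invertible. If its complement is invertible, it
    is 0, and then so is [idm A], which equals [v ∘ (u ∘ v) ∘ u]. *)
Lemma retract_local_iso A B :
  idm A <> 0 -> local_end B -> retract A B -> isomorphic A B.
Proof.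
move=> A0 [_ locB] [u [v vu]]; exists u; exists v; split=> //.
have ee : (u ∘ v) ∘ (u ∘ v) = u ∘ v by rewrite compA -[u ∘ v ∘ u]compA vu comp_idr.
case: (locB (u ∘ v)) => [[w [we ew]]|[w [we ew]]].
  by rewrite -[LHS]comp_idl -we -compA ee.
case: A0; rewrite -vu -[v ∘ u]comp_idr -vu compA -[v ∘ u ∘ v]compA.
suff -> : u ∘ v = 0 by rewrite comp0r comp0l.
rewrite -[LHS]comp_idl -we -compA compDl comp_idl compNl ee subrr comp0r //.
Qed.

(** Composed with the inverse of the sum, the first term and the rest add up to the identity, so one
    of them is invertible; induction handles the rest. *)
Lemma local_end_sum A (I : finType) (f : I -> hom T A A) :
  local_end A -> is_iso (\sum_i f i) -> exists i, is_iso (f i).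
Proof.
move=> [A0 locA]; rewrite unlock; elim: (index_enum I) => [|i s IHs] /=.
  by move=> [g [+ _]]; rewrite comp0r => e; case: A0.
set r := reducebig _ _ _ in IHs *.
move=> [g [gs sg]].
have giso : is_iso (f i + r) by exists g.
have invK (h : hom T A A) : is_iso (g ∘ h) -> is_iso h.
  move=> gh; have -> : h = (f i + r) ∘ (g ∘ h) by rewrite compA sg comp_idl.
  exact: is_iso_comp.
case: (locA (g ∘ f i)) => [/invK|]; first by exists i.
by rewrite -gs compDr addrC addKr => /invK /IHs.
Qed.

(** The identity of [A], routed through the decomposition of [S], is a sum of endomorphisms
    factoring through the [F i]; one of them is invertible. *)
Lemma local_end_summand A S (I : finType) (F : I -> T) :
  local_end A -> direct_sum F S -> retract A S -> exists i, retract A (F i).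
Proof.
move=> locA [inj [prj [_ _ e]]] [u [v vu]].
have : is_iso (\sum_i ((v ∘ inj i) ∘ (prj i ∘ u))).
  suff -> : \sum_i ((v ∘ inj i) ∘ (prj i ∘ u)) = idm A by exact: is_iso_id.
  rewrite -vu -[v in RHS]comp_idr -e comp_sumr comp_suml.
  by apply: eq_bigr => i _; rewrite !compA.
case/(local_end_sum locA) => i [w [we _]]; exists i, (prj i ∘ u), (w ∘ (v ∘ inj i)).
by rewrite -compA.
Qed.

Lemma direct_sum_retract S (I : finType) (F : I -> T) i :
  direct_sum F S -> retract (F i) S.
Proof. by move=> [inj [prj [e _ _]]]; exists (inj i), (prj i). Qed.

Lemma is_iso_idempotent A (e : hom T A A) : is_iso e -> e ∘ e = e -> e = idm A.
Proof. by move=> [g [ge _]] ee; rewrite -ge -[in RHS]ee compA ge comp_idl. Qed.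

(** One of the two idempotents of a decomposition is invertible, hence the identity, which kills the
    other summand. *)
Lemma local_end_indecomposable A : local_end A -> indecomposable A.
Proof.
move=> locA; split; first by move/is_zeroP; exact: locA.1.
move=> F [inj [prj [e1 e0 es]]].
have [b iso_b] : exists b, is_iso (inj b ∘ prj b).
  by apply: local_end_sum => //; rewrite es; exact: is_iso_id.
have idb : inj b ∘ prj b = idm A.
  by apply: is_iso_idempotent => //; rewrite compA -[_ ∘ _ ∘ inj b]compA e1 comp_idr.
exists (~~ b); apply/is_zeroP.
rewrite -e1 -[prj (~~ b)]comp_idr -idb compA e0 ?comp0l //.
by case: (b).
Qed.

(** Groups all summands but the first, because [indecomposable] speaks of two summands only. *)
Lemma direct_sum_ord2 m (F : 'I_m.+1 -> T) A S :
  direct_sum F A -> direct_sum (fun i : 'I_m => F (lift ord0 i)) S ->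
  direct_sum (fun b : bool => if b then F ord0 else S) A.
Proof.
move=> [inj [prj [e1 e0 es]]] [inj' [prj' [e1' e0' es']]].
pose J : hom T S A := \sum_i (inj (lift ord0 i) ∘ prj' i).
pose Q : hom T A S := \sum_i (inj' i ∘ prj (lift ord0 i)).
exists (fun b => if b as b return hom T (if b then F ord0 else S) A then inj ord0 else J).
exists (fun b => if b as b return hom T A (if b then F ord0 else S) then prj ord0 else Q).
have Qinj i : Q ∘ inj (lift ord0 i) = inj' i.
  rewrite comp_suml (bigD1 i) //= -compA e1 comp_idr big1 ?addr0 // => j ji.
  by rewrite -compA e0 ?comp0r // (inj_eq lift_inj) eq_sym.
split.
- case; first exact: e1.
  rewrite comp_sumr -es'; apply: eq_bigr => i _; by rewrite compA Qinj.
- case; case=> // _.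
    rewrite comp_suml big1 // => i _; by rewrite -compA e0 ?comp0r.
  rewrite comp_sumr big1 // => i _; by rewrite compA e0 ?comp0l.
rewrite big_bool /= -es big_ord_recl; congr (_ + _).
rewrite comp_sumr; apply: eq_bigr => i _; rewrite compA; congr (_ ∘ _).
rewrite comp_suml (bigD1 i) //= -compA e1' comp_idr big1 ?addr0 // => j ji.
by rewrite -compA e0' ?comp0r // eq_sym.
Qed.

(** The first summand of a Krull-Schmidt decomposition is non-zero, so the others sum to zero;
    locality is then carried over to [A] by conjugation. *)
Lemma indecomposable_local_end A :
  Defs.additive T -> krull_schmidt T -> indecomposable A -> local_end A.
Proof.
move=> addT ks [nzA indA]; have [[|m] [F [dsF locF]]] := ks A.
  case: nzA; case: dsF => [inj [prj [_ _ es]]].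
  by apply/is_zeroP; rewrite -es big_ord0.
have [S dsS] := addT m (fun i => F (lift ord0 i)).
have [[] /= /is_zeroP z] := indA _ (direct_sum_ord2 dsF dsS).
  by case: (locF ord0).
have [inj [prj [e1 _ es]]] := direct_sum_ord2 dsF dsS.
have fg : inj true ∘ prj true = idm A.
  rewrite -es big_bool /= -[inj false]comp_idr /= z.
  by rewrite comp0r comp0l addr0.
have gf : prj true ∘ inj true = idm (F ord0) by exact: (e1 true).
have [F0 locF0] := locF ord0; split.
  move/is_zeroP => z'; apply: F0; apply/is_zeroP.
  suff isoA : isomorphic A (F ord0) by exact: isomorphic_zero isoA z'.
  by exists (prj true); exists (inj true).
have tr (h : hom T A A) : is_iso (prj true ∘ h ∘ inj true) -> is_iso h.
  have iso1 : is_iso (inj true) by exists (prj true).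
  have iso2 : is_iso (prj true) by exists (inj true).
  move=> iso_h.
  have -> : h = inj true ∘ (prj true ∘ h ∘ inj true) ∘ prj true.
    by rewrite !compA fg comp_idl -compA fg comp_idr.
  by do 2 apply: is_iso_comp => //.
move=> f; have [/tr|] := locF0 (prj true ∘ f ∘ inj true); first by left.
move=> h; right; apply: tr.
by rewrite compDr compNr compDl compNl comp_idr gf.
Qed.

End LinearCategories.

(** * Subcategories and their local objects *)

Section Subcategories.
Variables (K : fieldType) (T : linear_category K).
Implicit Types A B S : T.

Lemma direct_sum_isomorphic (I : finType) (F G : I -> T) S :
  direct_sum F S -> (forall i, isomorphic (F i) (G i)) -> direct_sum G S.
Proof.
move=> [inj [prj [e1 e0 es]]] FG.
have f i := cid (FG i); have g i := cid (projT2 (f i)).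
have gf i : sval (g i) ∘ sval (f i) = idm (F i) by case: (projT2 (g i)).
have fg i : sval (f i) ∘ sval (g i) = idm (G i) by case: (projT2 (g i)).
exists (fun i => inj i ∘ sval (g i)), (fun i => sval (f i) ∘ prj i); split.
- by move=> i; rewrite compA -[_ ∘ _ ∘ inj i]compA e1 comp_idr fg.
- by move=> i j ij; rewrite compA -[_ ∘ _ ∘ inj i]compA e0 // comp0r comp0l.
rewrite -es; apply: eq_bigr => i _.
by rewrite compA -[_ ∘ _ ∘ sval (f i)]compA gf comp_idr.
Qed.

Lemma direct_sum_unique (I : finType) (F : I -> T) S S' :
  direct_sum F S -> direct_sum F S' -> isomorphic S S'.
Proof.
have mutual (J : finType) (G : J -> T) U V
    (inj : forall i, hom T (G i) U) (prj : forall i, hom T U (G i))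
    (inj' : forall i, hom T (G i) V) (prj' : forall i, hom T V (G i)) :
    biproduct inj prj -> biproduct inj' prj' ->
    (\sum_i (inj i ∘ prj' i)) ∘ (\sum_i (inj' i ∘ prj i)) = idm U.
  move=> [e1 e0 es] [e1' e0' es']; rewrite comp_suml -es; apply: eq_bigr => i _.
  rewrite -compA comp_sumr (bigD1 i) //= compA e1' comp_idl big1 ?addr0 // => j ji.
  by rewrite compA e0' // comp0l.
move=> [inj [prj b]] [inj' [prj' b']].
exists (\sum_i (inj' i ∘ prj i)), (\sum_i (inj i ∘ prj' i)).
by split; apply: mutual.
Qed.

Lemma direct_sum_ord1 A B : isomorphic A B -> direct_sum (fun _ : 'I_1 => A) B.
Proof.
move=> [f [g [gf fg]]]; exists (fun=> f), (fun=> g); split=> //.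
  by move=> i j; rewrite (ord1 i) (ord1 j) eqxx.
by rewrite big_ord1.
Qed.

Lemma subcategory_isomorphic (X : set T) A B :
  subcategory X -> isomorphic A B -> X A -> X B.
Proof. by move=> [sumX _] /direct_sum_ord1 /sumX h XA; exact: h. Qed.

Lemma subcategory_retract (X : set T) A S :
  krull_schmidt T -> subcategory X -> local_end A -> X S -> retract A S -> X A.
Proof.
move=> ks sX locA XS rAS; have [m [F [dsF locF]]] := ks S.
have [i rAF] := local_end_summand locA dsF rAS.
apply: (subcategory_isomorphic (A := F i)) => //; last exact: sX.2 dsF XS i.
by apply/isomorphic_sym/retract_local_iso => //; exact: locA.1.
Qed.

(** For fixed [A], the objects that have [A] as a retract only if [A] is isomorphic to a member of
    [G] form a subcategory containing [G]. *)
Lemma add_closure_local (G : set T) A :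
  (forall B, G B -> local_end B) -> local_end A -> add_closure G A ->
  exists2 B, G B & isomorphic A B.
Proof.
move=> locG locA.
pose X := [set S | retract A S -> exists2 B, G B & isomorphic A B].
move=> /(_ X) clA; suff : X A by apply; exact/isomorphic_retract/isomorphic_refl.
apply: clA; split; last first.
  move=> B GB rAB; exists B => //.
  by apply: retract_local_iso => //; [exact: locA.1|exact: locG].
split=> m F S dsF.
  move=> XF rAS; have [i rAF] := local_end_summand locA dsF rAS.
  exact: XF rAF.
move=> XS i rAF; apply: XS; apply: retract_trans rAF _.
exact: direct_sum_retract dsF.
Qed.

Lemma hom_perp_subcategory B :
  subcategory [set A | forall f : hom T A B, f = 0].
Proof.
split=> m F S [inj [prj [e1 e0 es]]] /=.
  move=> F0 f; rewrite -[f]comp_idr -es comp_sumr big1 // => i _.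
  by rewrite compA (F0 i (f ∘ inj i)) comp0l.
move=> S0 i f; rewrite -[f]comp_idr -e1 compA; set g := f ∘ _.
by rewrite (S0 g) comp0l.
Qed.

(** An object has finitely many local summands, and the maximum of their bounds works for all of
    them. *)
Lemma krull_schmidt_exhaust (Q : nat -> set T) :
  krull_schmidt T ->
  (forall k m (F : 'I_m -> T) S, direct_sum F S -> (forall i, Q k (F i)) -> Q k S) ->
  (forall A, local_end A -> exists k, forall l, (k <= l)%N -> Q l A) ->
  forall S, exists k, Q k S.
Proof.
move=> ks sumQ evQ S; have [m [F [dsF locF]]] := ks S.
have f i := cid (evQ _ (locF i)).
exists (\max_i sval (f i)); apply: sumQ dsF _ => i.
exact: (projT2 (f i)) (leq_bigmax i).
Qed.

End Subcategories.

(** * Suspension, split triangles and coaisles *)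

Section TriangulatedCategories.
Variables (K : fieldType) (T : triangulated_category K).
Implicit Types A B S : T.

Lemma sus_homD A B (f g : hom T A B) : sus_hom (f + g) = sus_hom f + sus_hom g.
Proof. by have := @sus_linear K T A B 1 f g; rewrite /= !scale1r. Qed.

Lemma sus_hom0 A B : sus_hom (0 : hom T A B) = 0.
Proof. by apply: (addIr (sus_hom 0)); rewrite -sus_homD !add0r. Qed.

Lemma direct_sum_sus (I : finType) (F : I -> T) S :
  direct_sum F S -> direct_sum (fun i => sus (F i)) (sus S).
Proof.
move=> [inj [prj [e1 e0 es]]].
exists (fun i => sus_hom (inj i)), (fun i => sus_hom (prj i)); split.
- by move=> i; rewrite -sus_comp e1 sus_id.
- by move=> i j ij; rewrite -sus_comp e0 // sus_hom0.
rewrite -sus_id -es (big_morph _ (@sus_homD S S) (@sus_hom0 S S)).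
by apply: eq_bigr => i _; rewrite sus_comp.
Qed.

Lemma direct_sum_iter_sus k (I : finType) (F : I -> T) S :
  direct_sum F S -> direct_sum (fun i => iter k sus (F i)) (iter k sus S).
Proof. by move=> dsF; elim: k => // k; exact: direct_sum_sus. Qed.

Lemma isomorphic_sus A B : isomorphic A B <-> isomorphic (sus A) (sus B).
Proof.
split=> [[f [g [gf fg]]]|[f [g [gf fg]]]].
  by exists (sus_hom f), (sus_hom g); rewrite -!sus_comp gf fg !sus_id.
have [u _ uK] := @sus_fully_faithful K T A B.
have [v _ vK] := @sus_fully_faithful K T B A.
exists (u f), (v g); split.
  by apply: (bij_inj (@sus_fully_faithful K T A A)); rewrite sus_comp uK vK gf sus_id.
by apply: (bij_inj (@sus_fully_faithful K T B B)); rewrite sus_comp uK vK fg sus_id.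
Qed.

Lemma isomorphic_iter_sus k A B :
  isomorphic A B <-> isomorphic (iter k sus A) (iter k sus B).
Proof. by elim: k => //= k IHk; rewrite IHk; exact: isomorphic_sus. Qed.

Lemma is_zero_sus A : is_zero A -> is_zero (sus A).
Proof. by move/is_zeroP => e; apply/is_zeroP; rewrite -sus_id e sus_hom0. Qed.

Lemma exists_zero : exists O : T, is_zero O.
Proof.
have F : 'I_0 -> T by case.
have [Z0 [inj [prj [_ _ es]]]] := @tri_additive K T 0 F.
by exists Z0; apply/is_zeroP; rewrite -es big_ord0.
Qed.

(** A morphism to the triangle on 0, [B], [B] that is the identity on the middle term provides a
    left inverse of [g]. *)
Lemma dist_split A B C (g : hom T B C) (h : hom T C (sus A)) :
  dist (0 : hom T A B) g h -> retract B C.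
Proof.
move=> d; have [Z0 zZ0] := exists_zero.
have d' : dist (0 : hom T Z0 B) (idm B) (0 : hom T B (sus Z0)).
  apply/dist_rot; rewrite sus_hom0 oppr0; apply: dist_id; exact: is_zero_sus.
have [|w [wg _]] := dist_morphism (u := (0 : hom T A Z0)) (v := idm B) d d'.
  by rewrite comp0r comp0l.
by exists g, w; rewrite wg comp_idl.
Qed.

(** The first map of the torsion triangle of [B] vanishes, so [B] is a retract of its coaisle
    part. *)
Lemma torsion_pair_coaisle (X Y : set T) B :
  krull_schmidt T -> torsion_pair X Y -> local_end B ->
  (forall A, X A -> forall f : hom T A B, f = 0) -> Y B.
Proof.
move=> ks [_ sY _ tri] locB perpB; have [A [C [f [g [h [XA YC d]]]]]] := tri B.
apply: subcategory_retract YC _ => //.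
by move: d; rewrite (perpB A XA f); exact: dist_split.
Qed.

End TriangulatedCategories.

(** * The aisle of a decorated partition *)

Section Partitions.
Variables (n : nat) (P : {set {set 'I_n}}).
Hypothesis partP : finset.partition P [set: 'I_n]%SET.

Definition same_block (i j : 'I_n) := exists2 B, B \in P & (i \in B) && (j \in B).

Lemma same_block_refl i : same_block i i.
Proof.
have : i \in finset.cover P by rewrite (finset.cover_partition partP) inE.
by move=> /finset.bigcupP[B BP iB]; exists B; rewrite ?iB.
Qed.

Lemma block_eq (B B' : {set 'I_n}) i :
  B \in P -> B' \in P -> i \in B -> i \in B' -> B = B'.
Proof.
have trivP := finset.partition_trivIset partP.
move=> BP B'P iB iB'; rewrite -(finset.def_pblock trivP BP iB).
exact: finset.def_pblock trivP B'P iB'.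
Qed.

Lemma coarsest_partitionP : (0 < n)%N ->
  P = [set [set: 'I_n]]%SET <-> (forall i j, same_block i j).
Proof.
move=> n0; split=> [eP i j|h]; first by exists [set: 'I_n]%SET; rewrite ?eP !inE.
have blockT B : B \in P -> B = [set: 'I_n]%SET.
  move=> BP; have [i iB] : exists i, i \in B.
    by apply/finset.set0Pn; apply: contraTneq BP => ->; case/and3P: partP.
  apply/finset.setP => j; rewrite inE; have [B' B'P /andP[iB' jB']] := h i j.
  by rewrite (block_eq BP B'P iB iB').
have [B BP _] := h (Ordinal n0) (Ordinal n0).
apply/finset.setP => B'; rewrite inE; apply/idP/eqP => [/blockT//|->].
by rewrite -(blockT B BP).
Qed.

Lemma finest_partitionP :
  P = [set [set i] | i : 'I_n]%SET <-> (forall i j, same_block i j -> i = j).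
Proof.
split=> [eP i j [B]|h].
  by rewrite eP => /imsetP[k _ ->]; rewrite !inE => /andP[/eqP-> /eqP->].
have block1 B i : B \in P -> i \in B -> B = [set i]%SET.
  move=> BP iB; apply/finset.setP => j; rewrite inE; apply/idP/eqP => [jB|->//].
  by apply: h; exists B; rewrite ?jB.
apply/finset.setP => B; apply/idP/imsetP => [BP|[i _ ->]].
  have [i iB] : exists i, i \in B.
    by apply/finset.set0Pn; apply: contraTneq BP => ->; case/and3P: partP.
  by exists i => //; exact: block1.
by have [B' B'P /andP[iB' _]] := same_block_refl i; rewrite -(block1 B' i).
Qed.

Lemma same_block_not_singleton i j : i <> j -> same_block i j -> ~ singleton_of P i.
Proof.
move=> ij [B BP /andP[iB jB]] siP.
have e := block_eq BP siP iB (set11 i).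
by move: jB; rewrite e inE => /eqP ji; apply: ij.
Qed.

End Partitions.

(** * Shifts of arcs, morphisms between arcs and arcs of the aisle *)

Section ClusterCategory.
Variables (R : realType) (K : fieldType) (Z : set (R * R)) (n : nat).
Variables (a : 'I_n -> R * R) (tau : R) (lo hi : 'I_n -> R).
Hypotheses (hZ : admissible Z) (ha : limit_points Z a) (hA : angles a tau lo hi).
Variable C : discrete_cluster_category K Z.
Local Notation zangles := (zangles Z lo hi).
Local Notation arc p q := (arc_ob C [set p; q]).

Lemma arc_ob_local_end A : is_arc Z A -> local_end (arc_ob C A).
Proof.
move=> /(arc_ob_indec C); apply: indecomposable_local_end.
  exact: tri_additive.
exact: dcc_krull_schmidt.
Qed.

Lemma local_end_arc (M : C) : local_end M ->
  exists p q, is_arc Z [set p; q] /\ isomorphic M (arc p q).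
Proof.
move=> /local_end_indecomposable /arc_ob_surj[A hAr iso].
by have [p [q [_ _ _ e]]] := hAr; exists p, q; rewrite -e.
Qed.

Lemma iter_sus_arc k p q : is_arc Z [set p; q] ->
  isomorphic (iter k sus (arc p q)) (arc (iter k (zpred Z) p) (iter k (zpred Z) q)) /\
  is_arc Z [set iter k (zpred Z) p; iter k (zpred Z) q].
Proof.
move=> pq; elim: k => [|k [iso arck]]; first by split=> //; exact: isomorphic_refl.
split; last exact: is_arc_zpred hZ ha hA _ _ arck.
by apply: isomorphic_trans (sus_arc C arck); apply: (isomorphic_sus _ _).1 iso.
Qed.

Lemma iter_sus_arc_zsucc k p q : is_arc Z [set p; q] ->
  isomorphic (iter k sus (arc (iter k (zsucc Z) p) (iter k (zsucc Z) q))) (arc p q) /\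
  is_arc Z [set iter k (zsucc Z) p; iter k (zsucc Z) q].
Proof.
move=> pq; elim: k => [|k [iso arck]]; first by split=> //; exact: isomorphic_refl.
have arcS := is_arc_zsucc hZ ha hA arck; split=> //.
have [Zp Zq _ _ _] := (is_arc_pair hZ ha hA _ _).1 arck.
apply: isomorphic_trans iso; rewrite iterSr.
have := sus_arc C arcS; rewrite /= !(zsuccK hZ ha hA) //.
by move/(isomorphic_iter_sus k).
Qed.

(** Shifting keeps each endpoint in its interval: undoing the shift takes successors for k = m and
    predecessors for negative k. This serves both the aisle and the coaisle. *)
Lemma shifted_arc (W : set C) i j t u : subcategory W -> i <> j ->
  zangles i t -> zangles j u ->
  (\bigcup_(k in [set: int]) sus_sub k W) (arc (circle_pt t) (circle_pt u)) ->
  exists t' u', [/\ zangles i t', zangles j u' & W (arc (circle_pt t') (circle_pt u'))].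
Proof.
move=> sW ij ti uj [[m|m] _ [B WB iso]]; have tu := is_arc_zangles hZ ha hA ij ti uj.
  have [t' t'i et] := iter_zsucc_zangles hZ ha hA m ti.
  have [u' u'j eu] := iter_zsucc_zangles hZ ha hA m uj.
  exists t', u'; split=> //; apply: subcategory_isomorphic WB => //.
  apply/(isomorphic_iter_sus m)/(isomorphic_trans (isomorphic_sym iso)).
  by rewrite -et -eu; apply/isomorphic_sym; exact: (iter_sus_arc_zsucc m tu).1.
have [t' t'i et] := iter_zpred_zangles hZ ha hA m.+1 ti.
have [u' u'j eu] := iter_zpred_zangles hZ ha hA m.+1 uj.
exists t', u'; split=> //; apply: subcategory_isomorphic WB => //.
apply: isomorphic_trans (isomorphic_sym iso) _.
by rewrite -et -eu; exact: (iter_sus_arc m.+1 tu).1.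
Qed.

Lemma isomorphic_sus_arc_zsucc p q : is_arc Z [set p; q] ->
  isomorphic (sus (arc (zsucc Z p) (zsucc Z q))) (arc p q).
Proof. by move=> pq; exact: (iter_sus_arc_zsucc 1 pq).1. Qed.

(** The target is the suspension of the arc with endpoints moved to their successors, so crossing
    that arc yields a morphism. *)
Lemma hom_arc_cross A p q : is_arc Z A -> is_arc Z [set p; q] ->
  cross A [set zsucc Z p; zsucc Z q] ->
  exists f : hom C (arc_ob C A) (arc p q), f <> 0.
Proof.
move=> hAr pq /(hom_cross C hAr (is_arc_zsucc hZ ha hA pq))[e e0 _].
have [g [h [hg gh]]] := isomorphic_sus_arc_zsucc pq.
exists (g ∘ e) => ge; apply: e0.
by rewrite -[e]comp_idl -hg -compA ge comp0r.
Qed.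

Lemma hom_arc_not_cross A p q : is_arc Z A -> is_arc Z [set p; q] ->
  ~ cross A [set zsucc Z p; zsucc Z q] ->
  forall f : hom C (arc_ob C A) (arc p q), f = 0.
Proof.
move=> hAr pq /(@hom_not_cross _ _ _ C _ _ hAr (is_arc_zsucc hZ ha hA pq)) v0 f.
have [g [h [hg gh]]] := isomorphic_sus_arc_zsucc pq.
by rewrite -[f]comp_idl -gh -compA (v0 (h ∘ f)) comp0r.
Qed.

Variables (P : {set {set 'I_n}}) (x : 'I_n -> R * R) (xi : 'I_n -> R).
Hypothesis hxi : forall i, [/\ xi i <= hi i, singleton_of P i -> xi i < hi i,
  ~ singleton_of P i -> lo i < xi i & forall j t, zangles j t ->
     itv_oc Z (a i) (x i) (circle_pt t) <-> lo i < t <= xi i].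

(** Arc objects are local and determine their arcs, so the additive closure contains no arcs besides
    the generating ones. *)
Lemma aisle_arc A : is_arc Z A -> aisle_of C a P x (arc_ob C A) <->
  exists2 B : {set 'I_n}, B \in P & A `<=` \bigcup_(i in [set` B]) itv_oc Z (a i) (x i).
Proof.
move=> hAr; split=> [|hB]; last by apply: sub_gen_smallest; exists A.
move=> /add_closure_local[_ [A' [hA' _] <-]||_ [A' [hA' hB] <-] iso].
- exact: arc_ob_local_end.
- exact: arc_ob_local_end.
- by rewrite (arc_ob_inj hAr hA' iso).
Qed.

Lemma zangles_itv i j t : zangles i t -> lo j < t <= xi j -> i = j.
Proof.
move=> [ti _] tj; have [xj _ _ _] := hxi j; apply: val_inj.
by case: (ltngtP i j) => // /(angles_order hA) h; exfalso; lra.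
Qed.

Lemma aisle_zangles i j t u : is_arc Z [set circle_pt t; circle_pt u] ->
  zangles i t -> zangles j u ->
  aisle_of C a P x (arc (circle_pt t) (circle_pt u)) <->
  [/\ same_block P i j, t <= xi i & u <= xi j].
Proof.
move=> tu ti uj; rewrite (aisle_arc tu); split=> [[B BP sub]|[[B BP /andP[iB jB]] tx ux]].
  have in_itv l s : zangles l s -> [set circle_pt t; circle_pt u] (circle_pt s) ->
      l \in B /\ s <= xi l.
    move=> sl /sub[k /= kB]; have [_ _ _ h] := hxi k.
    rewrite (h _ _ sl) => sk; rewrite (zangles_itv sl sk); split=> //; lra.
  have [iB tx] := in_itv _ _ ti (or_introl erefl).
  have [jB ux] := in_itv _ _ uj (or_intror erefl).
  by split=> //; exists B; rewrite ?iB.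
exists B => // _ [] ->; [exists i => //|exists j => //].
  by have [_ _ _ h] := hxi i; apply/(h _ _ ti); case: ti; lra.
by have [_ _ _ h] := hxi j; apply/(h _ _ uj); case: uj; lra.
Qed.

End ClusterCategory.

(** * Boundedness read off from the blocks of the partition *)

Theorem proposition4p21 (R : realType) (K : fieldType) (Z : set (R * R))
    (hZ : admissible Z) (n : nat) (a : 'I_n -> R * R) (ha : limit_points Z a)
    (C : discrete_cluster_category K Z) (hn : (2 <= n)%N)
    (X Y : set C) (hXY : t_structure X Y)
    (P : {set {set 'I_n}}) (hP : noncrossing_partition P)
    (x : 'I_n -> R * R) (hx : decoration Z a P x)
    (hX : X = aisle_of C a P x) :
  (bounded_above X Y <-> P = [set [set: 'I_n]]%SET) /\
  (bounded_below X Y <-> P = [set [set i] | i : 'I_n]%SET).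
Proof.
have [Zc _ _ _ _] := hZ.
have [tau [lo [hi hA]]] := limit_points_angles hn Zc ha.
have [xi hxi] := decoration_angles hA hx.
have [partP _] := hP.
have [torsXY _] := hXY; have [sX sY perpXY _] := torsXY.
have ks : krull_schmidt C by exact: dcc_krull_schmidt.
have mid i : exists t, zangles Z lo hi i t.
  by have [t ti _] := zangles_near_lo hZ ha hA (angles_lt hA i); exists t.
have inX := aisle_zangles hA C hxi.
rewrite -hX in inX.
split.
  rewrite (coarsest_partitionP partP (ltnW hn)); split=> [bX i j|sameP].
    have [<-|/eqP ij] := eqVneq i j; first exact: same_block_refl.
    (* Some shift of the aisle contains this arc, so the aisle has an arc between the same
       intervals, which puts [i] and [j] in one block. *)
    have [[t ti] [u uj]] := (mid i, mid j).
    have := shifted_arc (C := C) hZ ha hA sX ij ti uj.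
    rewrite bX => /(_ I)[t' [u' [t'i u'j]]].
    by move/(inX _ _ _ _ (is_arc_zangles hZ ha hA ij t'i u'j) t'i u'j) => -[].
  have lo_xi i : lo i < xi i.
    have [_ _ + _] := hxi i; apply.
    (* The index [ordS i] differs from [i], since the angle from a_i to a_(i+1) is positive and less
       than a turn. *)
    have [j ij] : exists j, i <> j.
      exists (ordS i) => e; have e' : circle_pt (lo i) = circle_pt (hi i).
        by rewrite -(angles_lo hA) -(angles_hi hA) -e.
      have := angles_lt hA i; have := angles_turn hA i => h1 h2.
      by have := circle_pt_inj _ e'; lra.
    exact: same_block_not_singleton (sameP i j).
  (* Suspensions bring both endpoints of an arc below the bounds [xi], and the single block imposes
     nothing more. *)
  have exk : forall S, exists k, X (iter k sus S).
    apply: (krull_schmidt_exhaust (Q := fun k => [set S | X (iter k sus S)]) ks).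
      move=> k m F S dsF; exact: sX.1 (direct_sum_iter_sus k dsF).
    move=> M /local_end_arc[p [q [pq iso]]].
    have [Zp Zq _ _ _] := (is_arc_pair hZ ha hA _ _).1 pq.
    have [i [t [ep ti]]] := zangles_exists hZ ha hA Zp.
    have [j [u [eq uj]]] := zangles_exists hZ ha hA Zq.
    have [k1 hk1] := iter_zpred_below hZ ha hA ti (lo_xi i).
    have [k2 hk2] := iter_zpred_below hZ ha hA uj (lo_xi j).
    exists (maxn k1 k2) => l; rewrite geq_max => /andP[kl1 kl2].
    have [t' [t'i t'x et]] := hk1 l kl1; have [u' [u'j u'x eu]] := hk2 l kl2.
    have [iso_l arc_l] := iter_sus_arc hZ ha hA C l pq.
    have iso_X := isomorphic_trans ((isomorphic_iter_sus l _ _).1 iso) iso_l.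
    apply: (subcategory_isomorphic sX (isomorphic_sym iso_X)).
    by move: arc_l; rewrite ep eq et eu => arc_l; apply/(inX _ _ _ _ arc_l t'i u'j).
  (* [Negz k] stands for [- k.+1], so the case of no suspension is separate. *)
  apply/seteqP; split=> // S _; have [[|k] XS] := exk S.
    by exists (Posz 0) => //; exists S => //; exact: isomorphic_refl.
  by exists (Negz k) => //; exists (iter k.+1 sus S) => //; exact: isomorphic_refl.
rewrite (finest_partitionP partP); split=> [bY i j ijP|diffP].
  apply: contrapT => ij; have ji := nesym ij.
  have jiP : same_block P j i by have [B BP /andP[iB jB]] := ijP; exists B; rewrite ?jB.
  have [_ _ /(_ (same_block_not_singleton partP ij ijP)) xi_i _] := hxi i.
  have [_ _ /(_ (same_block_not_singleton partP ji jiP)) xi_j _] := hxi j.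
  have [[t ti] [u uj]] := (mid i, mid j).
  have := shifted_arc (C := C) hZ ha hA sY ij ti uj.
  rewrite bY => /(_ I)[t' [u' [t'i u'j Yarc]]].
  have [s1 [s1i ts1 es1 _]] := zsucc_zangles hZ ha hA t'i.
  have [s2 [s2j us2 es2 _]] := zsucc_zangles hZ ha hA u'j.
  (* The arc from [v] to [w] is to lie below [xi], hence in the aisle, and below [s1] and [s2], so
     that it crosses the desuspended coaisle arc. The resulting non-zero morphism contradicts
     orthogonality. *)
  have lo_mini : lo i < Num.min (xi i) s1.
    by rewrite lt_min xi_i; case: s1i => /andP[].
  have [v vi] := zangles_near_lo hZ ha hA lo_mini.
  rewrite lt_min => /andP[vx vs].
  have lo_minj : lo j < Num.min (xi j) s2.
    by rewrite lt_min xi_j; case: s2j => /andP[].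
  have [w wj] := zangles_near_lo hZ ha hA lo_minj.
  rewrite lt_min => /andP[wx ws].
  have arc_vw := is_arc_zangles hZ ha hA ij vi wj.
  have arc_tu := is_arc_zangles hZ ha hA ij t'i u'j.
  have [|f] := hom_arc_cross hZ ha hA C arc_vw arc_tu.
    by rewrite es1 es2; exact: (cross_zangles hA ij vi s1i wj s2j).
  by apply; apply: perpXY Yarc _; apply/(inX _ _ _ _ arc_vw vi wj); split=> //; exact: ltW.
(* All blocks are singletons, so no x_i reaches a_(i+1). *)
have xi_hi i : xi i < hi i.
  have [_ + _ _] := hxi i; apply.
  have [B BP /andP[iB _]] := same_block_refl partP i.
  rewrite /singleton_of; suff <- : B = [set i]%SET by [].
  apply/finset.setP => j; rewrite inE; apply/idP/eqP => [jB|->//].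
  by apply/esym/diffP; exists B; rewrite ?iB.
have exk : forall S, exists k, sus_sub (Posz k) Y S.
  apply: (krull_schmidt_exhaust (Q := fun k => sus_sub (Posz k) Y) ks).
    (* The desuspended summands have a direct sum in [Y], whose k-fold suspension is [S] by
       uniqueness of direct sums. *)
    move=> k m F S dsF YF; have f i := cid2 (YF i).
    have [B dsB] := @tri_additive _ C m (fun i => sval (f i)).
    exists B; first by apply: sY.1 dsB _ => i; exact: s2valP (f i).
    apply: direct_sum_unique dsF _.
    apply: direct_sum_isomorphic (direct_sum_iter_sus k dsB) _ => i.
    exact: isomorphic_sym (s2valP' (f i)).
  move=> M /local_end_arc[p [q [pq iso]]].
  have [Zp Zq _ _ _] := (is_arc_pair hZ ha hA _ _).1 pq.
  have [i [t [ep ti]]] := zangles_exists hZ ha hA Zp.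
  have [j [u [eq uj]]] := zangles_exists hZ ha hA Zq.
  have [k1 hk1] := iter_zsucc_above hZ ha hA ti (xi_hi i).
  have [k2 hk2] := iter_zsucc_above hZ ha hA uj (xi_hi j).
  exists (maxn k1 k2) => l; rewrite geq_max => /andP[kl1 kl2].
  (* One step beyond [l], because morphisms into the arc are governed by crossings with its
     desuspension. *)
  have [t' [t'i t'x et]] := hk1 l.+1 (leqW kl1).
  have [u' [u'j u'x eu]] := hk2 l.+1 (leqW kl2).
  have [iso_l arc_l] := iter_sus_arc_zsucc hZ ha hA C l pq.
  exists (arc_ob C [set iter l (zsucc Z) p; iter l (zsucc Z) q]); last first.
    exact: isomorphic_trans iso (isomorphic_sym iso_l).
  apply: torsion_pair_coaisle ks torsXY (arc_ob_local_end C arc_l) _.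
  rewrite hX => A; pose perp := [set W : C | forall f :
    hom C W (arc_ob C [set iter l (zsucc Z) p; iter l (zsucc Z) q]), f = 0].
  (* Since [perp] is a subcategory, only the generating arcs need testing. *)
  suff : aisle_of C a P x `<=` perp by apply.
  apply: smallest_sub; first exact: hom_perp_subcategory.
  move=> _ [A' [hA' [B BP sub]] <-]; apply: (hom_arc_not_cross hZ ha hA) => //.
  rewrite -!iterS ep eq et eu.
  have [p1 [p2 [Zp1 Zp2 _ eA']]] := hA'.
  have [i1 [t1 [ep1 t1i]]] := zangles_exists hZ ha hA Zp1.
  have [i2 [t2 [ep2 t2i]]] := zangles_exists hZ ha hA Zp2.
  have arc12 : is_arc Z [set circle_pt t1; circle_pt t2] by rewrite -ep1 -ep2 -eA'.
  have : X (arc_ob C A') by rewrite hX; apply/aisle_arc => //; exists B.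
  rewrite eA' ep1 ep2 => /(inX _ _ _ _ arc12 t1i t2i)[/diffP i12 t1x t2x].
  rewrite -i12 in t2i t2x.
  (* The aisle arc lies in a single initial segment, ending at [xi i1]; each endpoint of the
     desuspended arc is beyond the segment of its own interval. *)
  apply: (not_cross_zangles hA t1i t2i t1x t2x t'i u'j).
    by move=> h; have e := zangles_itv hA hxi t'i h; move: h; rewrite -e leNgt t'x andbF.
  by move=> h; have e := zangles_itv hA hxi u'j h; move: h; rewrite -e leNgt u'x andbF.
apply/seteqP; split=> // S _; have [k YS] := exk S; by exists (Posz k).
Qed.
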